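(* Let $\Delta$ be a non-empty finite flag complex. If the rational cohomology $H^*(H_\Delta,\mathbf{Q})$ of the group $H_\Delta$ is finite-dimensional (in total, over all degrees), then the Euler characteristic of $\Delta$ satisfies $\chi(\Delta)=1$.
   Context: A finite flag complex $\Delta$ is a finite simplicial complex that contains a simplex bounding (spanning) every complete subgraph of its 1-skeleton. The associated right-angled Artin group $G_\Delta$ is the group presented with generators the vertex set of $\Delta$ and relators the commutators $[v,w]$ for each pair of adjacent vertices $v,w$ of $\Delta$. For $\Delta$ non-empty, there is a homomorphism $G_\Delta\to\mathbf{Z}$ sending every generator to $1$, and $H_\Delta$ denotes its kernel. Rational cohomology of a group means group cohomology with coefficients in the trivial module $\mathbf{Q}$. *)

(* Defs.v *)
From HB Require Import structures.
From mathcomp Require Import all_boot all_order all_algebra.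
From mathcomp Require Import generic_quotient ring_quotient.
From mathcomp Require Import boolp functions.

Set Implicit Arguments.
Unset Strict Implicit.
Unset Printing Implicit Defensive.

Import GRing.Theory.

Section Presentation.
Local Open Scope group_scope.
Local Open Scope quotient_scope.

(* The letter (x, true) stands for x, and (x, false) for x^-1. *)
Definition word (X : Type) := seq (X * bool).

Definition inv_letter X (l : X * bool) : X * bool := (l.1, ~~ l.2).

Definition inv_word X (w : word X) : word X := rev (map (@inv_letter X) w).

Variables (X : choiceType) (R : word X -> Prop).

Inductive pres_eqv : word X -> word X -> Prop :=
| pres_refl w : pres_eqv w w
| pres_sym u v : pres_eqv u v -> pres_eqv v u
| pres_trans u v w : pres_eqv u v -> pres_eqv v w -> pres_eqv u w
| pres_cancel u l v : pres_eqv (u ++ [:: l; inv_letter l] ++ v) (u ++ v)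
| pres_relator u r v : R r -> pres_eqv (u ++ r ++ v) (u ++ v).

Definition pres_eqvb : rel (word X) := fun u v => `[< pres_eqv u v >].

Lemma pres_eqvb_equiv : equiv_class_of pres_eqvb.
Proof.
split=> [w|u v|v u w].
- exact/asboolP/pres_refl.
- by apply/asboolP/asboolP; exact: pres_sym.
- by move=> /asboolP uv /asboolP vw; apply/asboolP; exact: pres_trans uv vw.
Qed.

Canonical pres_eqvb_equivRel := EquivRelPack pres_eqvb_equiv.
Canonical pres_eqvb_encModRel := defaultEncModRel pres_eqvb.

Definition presented := {eq_quot pres_eqvb}.

HB.instance Definition _ : EqQuotient (word X) pres_eqvb presented :=
  EqQuotient.on presented.
HB.instance Definition _ := Choice.on presented.

Lemma presentedP (u v : word X) :
  reflect (pres_eqv u v) (u == v %[mod presented]).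
Proof. by rewrite piE; apply: asboolP. Qed.

Lemma pres_eqv_ctx a b u v :
  pres_eqv u v -> pres_eqv (a ++ u ++ b) (a ++ v ++ b).
Proof.
elim=> [w|x y _|x y z _ xy _|x l y|x r y Rr].
- exact: pres_refl.
- exact: pres_sym.
- exact: pres_trans xy.
- by have := pres_cancel (a ++ x) l (y ++ b); rewrite -!catA.
- by have := pres_relator (a ++ x) (y ++ b) Rr; rewrite -!catA.
Qed.

Lemma inv_letterK : involutive (@inv_letter X).
Proof. by case=> x b; rewrite /inv_letter /= negbK. Qed.

Lemma inv_wordK : involutive (@inv_word X).
Proof.
by move=> w; rewrite /inv_word map_rev revK mapK //; exact: inv_letterK.
Qed.

Lemma inv_word_cat (u v : word X) :
  inv_word (u ++ v) = inv_word v ++ inv_word u.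
Proof. by rewrite /inv_word map_cat rev_cat. Qed.

Lemma pres_mulwV w : pres_eqv (w ++ inv_word w) [::].
Proof.
elim: w => [|l w IHw]; first exact: pres_refl.
rewrite -[l :: w]cat1s inv_word_cat -catA (catA w).
apply: pres_trans (pres_eqv_ctx [:: l] (inv_word [:: l]) IHw) _.
exact: (pres_cancel [::] l [::]).
Qed.

Lemma pres_mulVw w : pres_eqv (inv_word w ++ w) [::].
Proof. by have := pres_mulwV (inv_word w); rewrite inv_wordK. Qed.

Lemma pres_eqv_inv u v : pres_eqv u v -> pres_eqv (inv_word u) (inv_word v).
Proof.
move=> uv; apply: (@pres_trans _ (inv_word u ++ (v ++ inv_word v))).
  apply: pres_sym; have := pres_eqv_ctx (inv_word u) [::] (pres_mulwV v).
  by rewrite !cats0.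
apply: (@pres_trans _ (inv_word u ++ (u ++ inv_word v))).
  exact/pres_eqv_ctx/pres_sym.
have := pres_eqv_ctx [::] (inv_word v) (pres_mulVw u).
by rewrite !cat0s -catA.
Qed.

Definition pres_one : presented := lift_cst presented [::].
Definition pres_mul := lift_op2 presented (@cat (X * bool)).
Definition pres_inv := lift_op1 presented (@inv_word X).

Canonical pi_pres_one_morph := PiConst pres_one.

Lemma pi_pres_mul : {morph \pi_presented : u v / u ++ v >-> pres_mul u v}.
Proof.
move=> u v; unlock pres_mul; apply/eqP/presentedP.
have ru : pres_eqv u (repr (\pi_presented u)).
  by apply/presentedP; rewrite reprK.
have rv : pres_eqv v (repr (\pi_presented v)).
  by apply/presentedP; rewrite reprK.
apply: (pres_trans (pres_eqv_ctx [::] v ru)).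
by have := pres_eqv_ctx (repr (\pi_presented u)) [::] rv; rewrite !cats0.
Qed.
Canonical pi_pres_mul_morph := PiMorph2 pi_pres_mul.

Lemma pi_pres_inv : {morph \pi_presented : u / inv_word u >-> pres_inv u}.
Proof.
move=> u; unlock pres_inv; apply/eqP/presentedP/pres_eqv_inv.
by apply/presentedP; rewrite reprK.
Qed.
Canonical pi_pres_inv_morph := PiMorph1 pi_pres_inv.

Lemma pres_mulA : associative pres_mul.
Proof. by move=> x y z; rewrite -[x]reprK -[y]reprK -[z]reprK !piE catA. Qed.

Lemma pres_mul1g : left_id pres_one pres_mul.
Proof. by move=> x; rewrite -[x]reprK !piE cat0s. Qed.

Lemma pres_mulg1 : right_id pres_one pres_mul.
Proof. by move=> x; rewrite -[x]reprK !piE cats0. Qed.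

Lemma pres_mulVg : left_inverse pres_one pres_inv pres_mul.
Proof.
by move=> x; rewrite -[x]reprK !piE; apply/eqP/presentedP/pres_mulVw.
Qed.

Lemma pres_mulgV : right_inverse pres_one pres_inv pres_mul.
Proof.
by move=> x; rewrite -[x]reprK !piE; apply/eqP/presentedP/pres_mulwV.
Qed.

HB.instance Definition _ := isGroup.Build presented
  pres_mulA pres_mul1g pres_mulg1 pres_mulVg pres_mulgV.

Definition pres_gen (x : X) : presented := \pi_presented [:: (x, true)].

Variable T : groupType.

Definition word_eval (f : X -> T) (w : word X) : T :=
  \prod_(l <- w) (if l.2 then f l.1 else (f l.1)^-1).

Lemma word_eval_cat f u v : word_eval f (u ++ v) = word_eval f u * word_eval f v.
Proof. by rewrite /word_eval big_cat. Qed.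

(* The homomorphism that extends f, provided that f kills the relators. *)
Definition pres_lift (f : X -> T) (g : presented) : T := word_eval f (repr g).

Variables (f : X -> T) (fR : forall r, R r -> word_eval f r = 1).

Lemma word_eval_eqv u v : pres_eqv u v -> word_eval f u = word_eval f v.
Proof.
elim=> [//|//|a b c _ -> _ -> //|a l b|a r b Rr]; rewrite !word_eval_cat.
  suff -> : word_eval f [:: l; inv_letter l] = 1 by rewrite mul1g.
  rewrite /word_eval big_cons big_seq1.
  by case: l => x [] /=; rewrite ?mulgV ?mulVg.
by rewrite (fR Rr) mul1g.
Qed.

Lemma pres_lift_pi w : pres_lift f (\pi_presented w) = word_eval f w.
Proof. by apply: word_eval_eqv; apply/presentedP; rewrite reprK. Qed.

Lemma pres_lift_gen x : pres_lift f (pres_gen x) = f x.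
Proof. by rewrite pres_lift_pi /word_eval big_seq1. Qed.

Lemma pres_liftM : {morph pres_lift f : g h / g * h}.
Proof.
move=> g h; rewrite -[g]reprK -[h]reprK.
set a := repr g; set b := repr h.
have -> : \pi_presented a * \pi_presented b = \pi_presented (a ++ b).
  exact/esym/pi_pres_mul.
by rewrite !pres_lift_pi word_eval_cat.
Qed.

Lemma pres_lift1 : pres_lift f 1 = 1.
Proof. by apply: (mulgI (pres_lift f 1)); rewrite -pres_liftM !mulg1. Qed.

Lemma pres_lift_closed : group_closed [pred g | pres_lift f g == 1].
Proof.
split=> [|g h]; rewrite !inE ?pres_lift1 // => /eqP g1 /eqP h1.
have hV : pres_lift f h^-1 = 1.
  by have := pres_liftM h h^-1; rewrite mulgV pres_lift1 h1 mul1g => <-.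
by rewrite pres_liftM g1 hV mul1g.
Qed.

End Presentation.

Section Flag.
Variable V : finType.

(* Simplices are non-empty, and every element of V is a vertex. *)
Definition simplicial_complex (D : {set {set V}}) : Prop :=
  [/\ set0 \notin D,
      forall v, [set v] \in D &
      forall A B : {set V}, B \in D -> A \subset B -> A != set0 -> A \in D].

Definition adjacent (D : {set {set V}}) : rel V :=
  fun v w => (v != w) && ([set v; w] \in D).

Definition flag (D : {set {set V}}) : Prop :=
  forall A : {set V}, A != set0 ->
    {in A &, forall v w, v != w -> adjacent D v w} -> A \in D.

Definition euler_char (D : {set {set V}}) : int :=
  (\sum_(A in D) (-1) ^+ #|A|.-1)%R.

Variable D : {set {set V}}.

Definition raag_relator (r : word V) : Prop :=
  exists v w, adjacent D v w /\
    r = [:: (v, true); (w, true); (v, false); (w, false)].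

Definition raag := presented raag_relator.
HB.instance Definition _ := Group.on raag.

(* to_multiplicative int is the additive group of the integers, with its law
   written multiplicatively. *)
Definition height : raag -> Algebra.to_multiplicative int :=
  pres_lift (fun _ => 1%R : Algebra.to_multiplicative int).

Lemma height_relator r : raag_relator r ->
  word_eval (fun _ => 1%R : Algebra.to_multiplicative int) r = 1%g.
Proof.
by case=> v [w [_ ->]]; rewrite /word_eval !big_cons big_nil.
Qed.

Lemma height_gen v : height (pres_gen raag_relator v) = 1%R.
Proof. exact: pres_lift_gen height_relator _. Qed.

Lemma heightM : {morph height : g h / (g * h)%g}.
Proof. exact: pres_liftM height_relator. Qed.

(* The Bestvina-Brady group of D. *)
Definition bb_pred : pred raag := fun g => height g == 1%g.

Definition bb := {g : raag | bb_pred g}.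

HB.instance Definition _ := SubChoice.on bb.

Lemma bb_closed : group_closed bb_pred.
Proof. exact: pres_lift_closed height_relator. Qed.

HB.instance Definition _ :=
  SubChoice_isSubGroup.Build raag bb_pred bb bb_closed.

End Flag.

Local Open Scope ring_scope.

Section QuotientModule.
Local Open Scope quotient_scope.
Variables (k : pzRingType) (M : lmodType k) (S : submodClosed M).

(* Over a ring, a predicate closed under addition and scaling is closed under
   opposites, which Quotient.quot requires as an instance. *)
Definition submod_pred : {pred M} := S.

Lemma submod_pred_closed : zmod_closed submod_pred.
Proof.
split=> [|x y xS yS]; first exact: (rpred0 S).
by rewrite -scaleN1r; apply: (@rpredD _ S) => //; exact: rpredZ.
Qed.

HB.instance Definition _ := GRing.isZmodClosed.Build M submod_pred
  submod_pred_closed.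

Definition quot_mod := Quotient.quot submod_pred.
HB.instance Definition _ := GRing.Zmodule.on quot_mod.
HB.instance Definition _ : EqQuotient M (Quotient.equiv submod_pred) quot_mod :=
  EqQuotient.on quot_mod.

Definition quot_scale (a : k) (x : quot_mod) : quot_mod :=
  \pi_quot_mod (a *: repr x).

Lemma pi_quot_scale a x : quot_scale a (\pi_quot_mod x) = \pi_quot_mod (a *: x).
Proof.
apply/eqP; rewrite -(Quotient.idealrBE submod_pred) -scalerBr.
apply: (@rpredZ _ _ S).
by rewrite -[_ \in S]/(_ \in submod_pred) Quotient.idealrBE reprK.
Qed.

Lemma pi_quot_add x y :
  \pi_quot_mod (x + y) = \pi_quot_mod x + \pi_quot_mod y.
Proof. exact: (Quotient.pi_add submod_pred). Qed.

Lemma quot_scaleA a b x :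
  quot_scale a (quot_scale b x) = quot_scale (a * b) x.
Proof.
by elim/quotW: x => x; rewrite !(pi_quot_scale _ x) pi_quot_scale scalerA.
Qed.

Lemma quot_scale1 : left_id 1 quot_scale.
Proof. by move=> x; rewrite -[x]reprK pi_quot_scale scale1r. Qed.

Lemma quot_scaleDr : right_distributive quot_scale +%R.
Proof.
move=> a; elim/quotW=> x; elim/quotW=> y.
rewrite -pi_quot_add (pi_quot_scale a x) (pi_quot_scale a y).
by rewrite (pi_quot_scale a (x + y)) -pi_quot_add scalerDr.
Qed.

Lemma quot_scaleDl x : {morph quot_scale^~ x : a b / a + b}.
Proof.
elim/quotW: x => x a b; rewrite !(pi_quot_scale _ x).
by rewrite -pi_quot_add scalerDl.
Qed.

HB.instance Definition _ := GRing.Zmodule_isLmodule.Build k quot_mod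
  quot_scaleA quot_scale1 quot_scaleDr quot_scaleDl.

End QuotientModule.

(* Cohomology of the complex of G-invariant homogeneous cochains, that is
   of Hom_G(F_n, k) where F_n is the free module on G^(n+1), the standard
   resolution of the trivial module. *)
Section Cohomology.
Variables (k : fieldType) (G : groupType).

Definition cochain n := ('I_n.+1 -> G) -> k^o.
HB.instance Definition _ n := GRing.Lmodule.on (cochain n).

Definition invariant n (c : cochain n) : Prop :=
  forall (h : G) (g : 'I_n.+1 -> G), c (fun i => (h * g i)%g) = c g.

Definition cobound n (c : cochain n) : cochain n.+1 :=
  fun g => \sum_(i < n.+2) (-1) ^+ i * c (fun j => g (lift i j)).

Definition cocycle_pred n : pred (cochain n) :=
  fun c => `[< invariant c /\ cobound c = 0 >].

Definition is_coboundary n : cochain n -> Prop :=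
  match n with
  | 0 => fun c => c = 0
  | m.+1 => fun c => exists b : cochain m, invariant b /\ c = cobound b
  end.

Lemma invariantP n a (b c : cochain n) :
  invariant b -> invariant c -> invariant (a *: b + c).
Proof. by move=> ib ic h g; rewrite !fctE /= ib ic. Qed.

Lemma coboundP n a (b c : cochain n) :
  cobound (a *: b + c) = a *: cobound b + cobound c.
Proof.
apply/funext=> g; rewrite /cobound !fctE scaler_sumr -big_split /=.
by apply: eq_bigr => i _; rewrite mulrDr -[a *: b _]/(a * b _) mulrCA.
Qed.

Lemma cobound0 n : cobound (0 : cochain n) = 0.
Proof. by apply/funext=> g; rewrite /cobound big1 // => i _; rewrite mulr0. Qed.

Lemma cocycle_closed n : submod_closed (@cocycle_pred n).
Proof.
split=> [|a b c /asboolP[ib db] /asboolP[ic dc]]; apply/asboolP.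
  by split; [| exact: cobound0].
by split; [exact: invariantP | rewrite coboundP db dc scaler0 addr0].
Qed.

Definition cocycle n := {c : cochain n | cocycle_pred c}.
HB.instance Definition _ n := SubChoice.on (cocycle n).
HB.instance Definition _ n := GRing.SubChoice_isSubLmodule.Build k
  (cochain n) (@cocycle_pred n) (cocycle n) (@cocycle_closed n).

Definition coboundary n : {pred cocycle n} :=
  fun c => `[< is_coboundary (val c) >].

Lemma coboundary_closed n : submod_closed (@coboundary n).
Proof.
split=> [|a b c /asboolP cb /asboolP cc]; apply/asboolP.
  rewrite raddf0; case: n => [//|n] /=.
  by exists 0; split=> //; rewrite cobound0.
rewrite linearP; case: n b c cb cc => [|n] b c /=.
  by move=> -> ->; rewrite scaler0 addr0.
move=> [b' [ib ->]] [c' [ic ->]]; exists (a *: b' + c').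
by split; [exact: invariantP | rewrite coboundP].
Qed.

HB.instance Definition _ n := GRing.isSubmodClosed.Build k (cocycle n)
  (@coboundary n) (@coboundary_closed n).

Definition cohomology n : lmodType k := quot_mod (@coboundary n).

End Cohomology.

Definition finite_dim (k : fieldType) (M : lmodType k) : Prop :=
  exists s : seq M, forall x : M, exists a : 'I_(size s) -> k,
    x = \sum_(i < size s) a i *: s`_i.

(* The direct sum of the M n over all n is finite-dimensional. *)
Definition total_finite_dim (k : fieldType) (M : nat -> lmodType k) : Prop :=
  (forall n, finite_dim (M n)) /\
  (exists N, forall n, (N <= n)%N -> forall x : M n, x = 0).

(* Main.v *)
Require Import Defs.
From HB Require Import structures.
From mathcomp Require Import all_boot all_order all_algebra.
From mathcomp Require Import generic_quotient ring_quotient.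
From mathcomp Require Import boolp functions zify ring lra.

(** Let [G] be the right-angled Artin group and [H] the kernel of [height].  The
    Magnus expansion sends a generator [v] to [1 + v] in the power series over
    the trace monoid of the graph; dually, [G] acts on the finitely supported
    functions on this monoid.  The Koszul complex [K] of the trace monoid, made
    of the functions [f w A] of a trace [w] and a clique [A], is a [G]-equivariant
    coresolution of the trivial module: a contraction moves a chosen letter
    that can stand last in [w A] between [w] and [A].  Iterating conjugates of
    this contraction turns cocycles of [K] that are fixed by [H] into cocycles of
    the standard complex of [H] (the map [psi]).

    A reduced cocycle [z] of the flag complex and a function [q] of the length of
    a trace give such a cocycle [q (size w) * z A].  Pulling it back to the
    cubical cochains of [G] (functions on [G] times cliques) shows that its class
    in the cohomology of [H] vanishes only if [q = 0] or [z] is a coboundary.  So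
    a non-zero reduced cohomology class of the complex in degree [n - 1] makes the
    cohomology of [H] in degree [n] infinite-dimensional.  Hence all reduced
    cohomology vanishes, and the Euler characteristic is 1. *)

Set Implicit Arguments.
Unset Strict Implicit.
Unset Printing Implicit Defensive.

Import GRing.Theory Num.Theory.
Local Open Scope ring_scope.
Local Open Scope quotient_scope.

(** * Simplicial cochains and the Euler characteristic *)

Section Signs.
Variable V : finType.
Implicit Types (v w : V) (A : {set V}).

Definition ksgn v A : rat :=
  (-1) ^+ #|[set u in A | (enum_rank u < enum_rank v)%N]|.

Lemma ksgnD1 v A : ksgn v (A :\ v) = ksgn v A.
Proof.
rewrite /ksgn; congr (_ ^+ #|pred_of_set _|); apply/setP=> u; rewrite !inE.
by case: eqP => [->|//]; rewrite ltnn !andbF.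
Qed.

Lemma ksgnK v A : ksgn v A * ksgn v A = 1.
Proof. by rewrite /ksgn -expr2 sqrr_sign. Qed.

Lemma ksgnU1 v a A : a \notin A ->
  ksgn v (a |: A) = (-1) ^+ (enum_rank a < enum_rank v)%N * ksgn v A.
Proof.
move=> aA; rewrite /ksgn -exprD; congr (_ ^+ _).
have -> : [set u in a |: A | (enum_rank u < enum_rank v)%N] =
  if (enum_rank a < enum_rank v)%N
  then a |: [set u in A | (enum_rank u < enum_rank v)%N]
  else [set u in A | (enum_rank u < enum_rank v)%N].
  apply/setP=> u; case: ifP => av; rewrite !inE; case: eqP => [->|_] //=.
  by rewrite av andbF.
by case: ifP => // _; rewrite cardsU1 !inE (negPf aA).
Qed.

Lemma ksgn_swap v a A : v \in A -> a \notin A ->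
  ksgn a A * ksgn v (a |: A) = - (ksgn v A * ksgn a (A :\ v)).
Proof.
move=> vA aA; have va : v != a by apply: contraNneq aA => <-.
have -> : ksgn a A = ksgn a (v |: (A :\ v)) by rewrite setD1K.
rewrite !ksgnU1 ?inE ?eqxx //.
have: enum_rank v != enum_rank a by rewrite (inj_eq enum_rank_inj).
by rewrite neq_ltn => /orP[] h; rewrite h ltnNge (ltnW h) /=; ring.
Qed.

Lemma ksgn_swap2 v w A : v \in A -> w \in A -> v != w ->
  ksgn v A * ksgn w (A :\ v) = - (ksgn w A * ksgn v (A :\ w)).
Proof.
move=> vA wA vw.
have := @ksgn_swap v w (A :\ w).
rewrite setD1K // !inE vw vA eqxx => /(_ isT isT).
rewrite ksgnD1 setDDl setUC -setDDl ksgnD1 => e.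
have: ksgn w A * ksgn v A * (ksgn v A * ksgn v (A :\ w))
   = - (ksgn v (A :\ w) * ksgn w (A :\ v)) * (ksgn v A * ksgn v (A :\ w)).
  by rewrite e.
have k1 := ksgnK v A; have k2 := ksgnK v (A :\ w).
have -> : ksgn w A * ksgn v A * (ksgn v A * ksgn v (A :\ w)) =
  (ksgn v A * ksgn v A) * (ksgn w A * ksgn v (A :\ w)) by ring.
have -> : - (ksgn v (A :\ w) * ksgn w (A :\ v)) * (ksgn v A * ksgn v (A :\ w))
  = - ((ksgn v (A :\ w) * ksgn v (A :\ w)) * (ksgn v A * ksgn w (A :\ v))).
  by ring.
by rewrite k1 k2 !mul1r => ->; rewrite opprK.
Qed.

(** Exchanging the two summation variables turns the sum into its opposite. Both proofs that a
    coboundary squares to zero, simplicial and cubical, reduce to this. *)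
Lemma alternating_sum A (F : V -> V -> rat) :
  {in A &, forall v w, v != w -> F v w = - F w v} ->
  \sum_(v in A) \sum_(w in A :\ v) F v w = 0.
Proof.
move=> FN; set S := \sum_(v in A) _.
suff: S = - S by lra.
rewrite {1}/S (exchange_big_dep (mem A)) /=; last first.
  by move=> v w _; rewrite !inE => /andP[].
rewrite /S -sumrN; apply: eq_bigr => w wA; rewrite -sumrN.
apply: eq_big => [v|v /andP[vA]]; first by rewrite !inE wA andbT eq_sym andbC.
by rewrite !inE => /andP[vw _]; apply: FN; rewrite // eq_sym.
Qed.

Definition sdiff (z : {set V} -> rat) A : rat :=
  \sum_(v in A) ksgn v A * z (A :\ v).

Lemma sdiff_sdiff z A : sdiff (sdiff z) A = 0.
Proof.
rewrite /sdiff; under eq_bigr do rewrite mulr_sumr.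
apply: (alternating_sum
  (F := fun v w => ksgn v A * (ksgn w (A :\ v) * z (A :\ v :\ w)))).
move=> v w vA wA vw; rewrite !mulrA (ksgn_swap2 vA wA vw) !mulNr.
by rewrite !setDDl [[set v] :|: _]setUC.
Qed.

End Signs.

(** * Reduced Euler characteristic by ranks of coboundary matrices *)

Section EulerPoincare.
Variables (V : finType) (F : {set {set V}}).
Hypothesis FD1 : forall A v, A \in F -> v \in A -> A :\ v \in F.

Local Notation m := #|{set V}|.
Local Notation st := (@enum_val {set V} (mem {set V})).
Local Notation rk := (@enum_rank {set V}).
Local Notation nfaces n := [set A in F | #|A| == n].

Let row_diff (x : 'rV[rat]_m) : 'rV[rat]_m :=
  \row_j ((st j \in F)%:R * sdiff (fun A => x 0 (rk A)) (st j)).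

Let row_diff_linear : linear row_diff.
Proof.
move=> a x y; apply/rowP=> j; rewrite !mxE mulrCA -mulrDr; congr (_ * _).
rewrite /sdiff mulr_sumr -big_split /=.
by apply: eq_bigr => v _; rewrite !mxE mulrDr mulrCA.
Qed.

HB.instance Definition _ :=
  GRing.isLinear.Build rat _ _ _ row_diff row_diff_linear.

Let M : 'M[rat]_m := lin1_mx row_diff.

(** Subspaces are encoded as row spaces: [P n] spans the cochains supported on faces with [n]
    vertices, [B n] the coboundaries among them. The index is thus the simplicial degree plus one,
    and the empty face counts. *)
Let P n : 'M[rat]_(#|nfaces n|, m) :=
  \matrix_(i, j) (enum_val i == st j :> {set V})%:R.

Let B n : 'M[rat]_m := if n is n'.+1 then <<P n' *m M>>%MS else 0.

Let rank_P n : \rank (P n) = #|nfaces n|.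
Proof.
apply/eqP; rewrite -/(row_free (P n)); apply/row_freeP; exists (P n)^T.
apply/matrixP=> i j; rewrite !mxE (bigD1 (rk (enum_val i))) //= big1.
  by rewrite !mxE enum_rankK eqxx mul1r addr0 eq_sym (inj_eq enum_val_inj).
move=> k /negPf ne; rewrite !mxE -(inj_eq (@enum_rank_inj {set V})) enum_valK.
by rewrite eq_sym ne mul0r.
Qed.

Let sub_PP n (x : 'rV_m) :
  reflect (forall A, x 0 (rk A) != 0 -> A \in nfaces n) (x <= P n)%MS.
Proof.
apply: (iffP submxP) => [[D ->] A|supp].
  apply: contraR => An; rewrite mxE big1 // => i _; rewrite mxE enum_rankK.
  by case: eqP => [e|]; rewrite ?mulr0 //; rewrite -e enum_valP in An.
exists (\row_i x 0 (rk (enum_val i))); apply/rowP=> j; rewrite mxE.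
have [jn|jn] := boolP (st j \in nfaces n).
  rewrite (bigD1 (enum_rank_in jn (st j))) //= big1 => [|i].
    by rewrite !mxE enum_rankK_in // eqxx mulr1 addr0 enum_valK.
  rewrite !mxE => ne; case: eqP => [e|]; rewrite ?mulr0 //.
  by case/eqP: ne; apply: enum_val_inj; rewrite enum_rankK_in.
rewrite big1 => [|i _].
  by apply/eqP; apply: contraR jn => ?; apply: supp; rewrite enum_valK.
rewrite !mxE; case: eqP => [e|]; rewrite ?mulr0 //.
by rewrite -e enum_valP in jn.
Qed.

Let mulM (x : 'rV_m) A :
  (x *m M) 0 (rk A) = (A \in F)%:R * sdiff (fun A => x 0 (rk A)) A.
Proof. by rewrite mul_rV_lin1 mxE enum_rankK. Qed.

Let sub_PM n (x : 'rV_m) : (x <= P n)%MS -> (x *m M <= P n.+1)%MS.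
Proof.
move=> /sub_PP supp; apply/sub_PP => A; rewrite mulM inE.
have [AF|] := boolP (A \in F); last by rewrite mul0r eqxx.
rewrite mul1r; apply: contraR => An; rewrite /sdiff big1 // => v vA.
suff /eqP -> : x 0 (rk (A :\ v)) == 0 by rewrite mulr0.
apply: contraR An => /supp; rewrite inE => /andP[_ /eqP <-].
by rewrite (cardsD1 v A) vA add1n eqxx.
Qed.

Let M_sqr (x : 'rV_m) : x *m M *m M = 0.
Proof.
apply/rowP=> j; rewrite -[j]enum_valK mulM mxE.
have [AF|] := boolP (_ \in F); last by rewrite mul0r.
rewrite mul1r -[RHS](sdiff_sdiff (fun A => x 0 (rk A)) (st j)).
by apply: eq_bigr => v vA; rewrite mulM FD1 // mul1r.
Qed.

Let B_sub n : (B n <= P n :&: kermx M)%MS.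
Proof.
case: n => [|n]; first exact: sub0mx.
rewrite /B genmxE; apply/row_subP=> i; rewrite row_mul sub_capmx.
by rewrite sub_PM ?row_sub // sub_kermx M_sqr eqxx.
Qed.

(** By exactness and rank-nullity, each number of faces is a sum of two consecutive ranks, so the
    alternating sum telescopes. *)
Let euler_exact : (forall n, P n :&: kermx M <= B n)%MS ->
  \sum_(A in F) (-1) ^+ #|A| = 0 :> int.
Proof.
move=> ex; pose r n := \rank (P n *m M).
have rank_faces n : #|nfaces n| = (r n + if n is n'.+1 then r n' else 0)%N.
  rewrite -rank_P -(mxrank_mul_ker (P n) M); congr (_ + _)%N.
  have -> : \rank (P n :&: kermx M) = \rank (B n).
    by apply/eqmx_rank/andP.
  by case: n => [|n]; rewrite /B ?mxrank0 // mxrank_gen.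
have partial k :
    \sum_(n < k.+1) (-1) ^+ n * #|nfaces n|%:R = (-1) ^+ k * (r k)%:R :> int.
  elim: k => [|k IHk]; first by rewrite big_ord1 rank_faces addn0.
  by rewrite big_ord_recr IHk /= rank_faces natrD exprS; ring.
(* The coboundary would live on sets with more than [#|V|] elements. *)
have r0 : r #|V| = 0%N.
  apply/eqP; rewrite mxrank_eq0 -submx0; apply/row_subP=> i; rewrite row_mul.
  have /sub_PP h := sub_PM (row_sub i (P #|V|)).
  rewrite submx0; apply/eqP/rowP=> j; rewrite -[j]enum_valK [RHS]mxE; apply/eqP.
  apply: contraTT (max_card (mem (st j))) => /h; rewrite inE.
  by move=> /andP[_ /eqP ->]; rewrite ltnn.
transitivity (\sum_(n < #|V|.+1) (-1) ^+ n * #|nfaces n|%:R : int); last first.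
  by rewrite partial r0 mulr0.
rewrite (partition_big (fun A : {set V} => inord #|A| : 'I_#|V|.+1) predT) //=.
apply: eq_bigr => n _; rewrite -[#|nfaces n|]sum1_card natr_sum mulr_sumr.
apply: eq_big => [A|A /andP[_ /eqP <-]].
  rewrite inE; congr (_ && _); apply/eqP/eqP=> [<-|->]; last exact: inord_val.
  by rewrite inordK // ltnS max_card.
by rewrite mulr1 inordK // ltnS max_card.
Qed.

(* [z] is a reduced cocycle and [f] a reduced cycle that detects it. *)
Lemma face_cochain_class :
  \sum_(A in F) (-1) ^+ #|A| != 0 :> int ->
  exists n (z f : {set V} -> rat),
    [/\ forall A, z A != 0 -> (A \in F) && (#|A| == n),
        forall A, A \in F -> sdiff z A = 0,
        forall y, \sum_(A in F | #|A| == n) f A * sdiff y A = 0 &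
        \sum_(A in F | #|A| == n) f A * z A != 0].
Proof.
move=> chi; have /existsNP[n /negP nex] :
    ~ forall n, (P n :&: kermx M <= B n)%MS.
  by move=> /euler_exact e; rewrite e eqxx in chi.
case/row_subPn: nex => i; set x := row i _ => xB.
have /andP[/sub_PP supp] : (x <= P n)%MS && (x <= kermx M)%MS.
  by rewrite -sub_capmx row_sub.
rewrite sub_kermx => /eqP xM.
move: xB; rewrite submxE => /rV0Pn[j fj].
(* Every column of the cokernel matrix kills [B n], hence is a cycle; column [j] is one that does
   not kill the cocycle [x]. *)
pose z A := x 0 (rk A); pose f A := cokermx (B n) (rk A) j.
have sum_f (u : 'rV_m) : (forall A, u 0 (rk A) != 0 -> A \in nfaces n) ->
    (u *m cokermx (B n)) 0 j = \sum_(A in F | #|A| == n) f A * u 0 (rk A).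
  move=> su; rewrite mxE (reindex rk) /=; last exact/onW_bij/enum_rank_bij.
  rewrite (bigID (mem (nfaces n))) /= [X in _ + X]big1 => [|A An].
    by rewrite addr0; apply: eq_big => [A|A _]; rewrite ?inE // mulrC.
  suff /eqP -> : u 0 (rk A) == 0 by rewrite mul0r.
  by apply: contraR An => /su.
exists n, z, f; split=> [A /supp|A AF|y|]; first by rewrite inE.
- by have := mulM x A; rewrite xM mxE AF mul1r.
- case: n @x @z f {supp xM fj} sum_f => [|n] x z f sum_f.
    apply: big1 => A /andP[_]; rewrite cards_eq0 => /eqP ->.
    by rewrite /sdiff big_set0 mulr0.
  (* Only the values of [y] on faces with one vertex less enter the sum, so [y] is cut down to them
     to land in [P n]. *)
  pose u : 'rV[rat]_m := \row_j ((st j \in nfaces n)%:R * y (st j)).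
  have uP : (u <= P n)%MS.
    apply/sub_PP=> A; rewrite mxE enum_rankK.
    by case: (A \in _); rewrite ?mul0r ?eqxx.
  have /sub_PP uMP := sub_PM uP.
  have : (u *m M *m cokermx (B n.+1)) = 0.
    by apply/eqP; rewrite -submxE /B genmxE submxMr.
  move=> /matrixP /(_ 0 j); rewrite sum_f // mxE => e; rewrite -[RHS]e.
  apply: eq_bigr => A /andP[AF An]; rewrite mulM AF mul1r; congr (_ * _).
  apply: eq_bigr => v vA; rewrite mxE enum_rankK inE FD1 //=.
  by move: An; rewrite (cardsD1 v) vA eqSS => ->; rewrite mul1r.
- by rewrite -sum_f.
Qed.

End EulerPoincare.

(** * Comparison with the standard complex *)

Section ListCochains.

(** The homogeneous coboundary, with the first entry split off to match the recursions of [psi] and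
    [phi]; [ldiffE] recovers the usual alternating sum. *)
Fixpoint ldiff (T : Type) (b : seq T -> rat) (l : seq T) : rat :=
  if l is x :: l' then b l' - ldiff (fun m => b (x :: m)) l' else 0.

Lemma eq_ldiff (T : Type) (b b' : seq T -> rat) n (l : seq T) :
  size l = n.+1 -> (forall m, size m = n -> b m = b' m) -> ldiff b l = ldiff b' l.
Proof.
elim: l n b b' => [//|x l IHl] n b b' [sl] bb' /=; rewrite bb' //.
congr (_ - _); case: n sl bb' => [/size0nil -> //|n sl bb'].
by apply: (IHl n) => // m sm; rewrite bb' //= sm.
Qed.

Lemma ldiff_map (S T : Type) (f : S -> T) (b : seq T -> rat) l :
  ldiff (fun m => b (map f m)) l = ldiff b (map f l).
Proof. by elim: l b => //= x l IHl b; rewrite (IHl (fun m => b (f x :: m))). Qed.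

Lemma ldiffE (T : Type) (u : seq T -> rat) (l : seq T) :
  ldiff u l = \sum_(i < size l) (-1) ^+ i * u (take i l ++ drop i.+1 l).
Proof.
elim: l u => [|x l IHl] u /=; first by rewrite big_ord0.
rewrite big_ord_recl /= drop0 expr0 mul1r IHl -sumrN; congr (_ + _).
by apply: eq_bigr => i _; rewrite /= exprS -mulNr; congr (_ * _); ring.
Qed.

End ListCochains.

Section Comparison.
Variables (V : finType) (F : {set {set V}}).
Hypothesis F0 : set0 \in F.
Hypothesis FD1 : forall A v, A \in F -> v \in A -> A :\ v \in F.

Variables (G : groupType) (gen : V -> G).
Hypothesis gen_comm : forall A, A \in F ->
  {in A &, forall v w, (gen v * gen w = gen w * gen v)%g}.

Implicit Types (g h k : G) (v w : V) (A B : {set V}) (b : G -> {set V} -> rat).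

(** Cubical coboundary: [(g, A)] stands for the cube with base vertex [g] and edge directions
    [gen v] for [v] in [A], and each summand compares two opposite facets. *)
Definition cdiff (b : G -> {set V} -> rat) g A : rat :=
  \sum_(v in A) ksgn v A * (b (g * gen v)%g (A :\ v) - b g (A :\ v)).

Lemma cdiff0 b g : cdiff b g set0 = 0.
Proof. by rewrite /cdiff big_set0. Qed.

Lemma eq_cdiff b b' g A :
  (forall g v, v \in A -> b g (A :\ v) = b' g (A :\ v)) ->
  cdiff b g A = cdiff b' g A.
Proof. by move=> bb'; apply: eq_bigr => v vA; rewrite !bb'. Qed.

Lemma cdiffB b b' g A :
  cdiff (fun g A => b g A - b' g A) g A = cdiff b g A - cdiff b' g A.
Proof. by rewrite /cdiff -sumrB; apply: eq_bigr => v _; ring. Qed.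

Lemma cdiff_cdiff b g A : A \in F -> cdiff (cdiff b) g A = 0.
Proof.
move=> AF; rewrite {1}/cdiff.
under eq_bigr do rewrite /cdiff -sumrB mulr_sumr.
apply: (alternating_sum (F := fun v w => ksgn v A *
  (ksgn w (A :\ v) * (b (g * gen v * gen w)%g (A :\ v :\ w) -
                      b (g * gen v)%g (A :\ v :\ w)) -
   ksgn w (A :\ v) * (b (g * gen w)%g (A :\ v :\ w) - b g (A :\ v :\ w))))).
move=> v w vA wA vw; rewrite -!mulrBr !mulrA (ksgn_swap2 vA wA vw) !mulNr.
rewrite !setDDl [[set v] :|: _]setUC -!mulgA (gen_comm AF vA wA).
by ring.
Qed.

(** A complex with a right action of [G], contractible onto the line of [eta]. The hypothesis
    [coef_d] makes [c] mapped to [coef A (act g c)] a cochain map into the cubical cochains. *)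
Variables (K : lmodType rat) (act : G -> {linear K -> K}).
Variables (d s : {linear K -> K}) (coef : {set V} -> {linear K -> rat^o}).
Variable eta : K.
Hypothesis actM : forall g h c, act (g * h)%g c = act h (act g c).
Hypothesis act1 : forall c, act 1%g c = c.
Hypothesis act_d : forall g c, act g (d c) = d (act g c).
Hypothesis contraction : forall c, d (s c) + s (d c) = c - coef set0 c *: eta.
Hypothesis s_eta : s eta = 0.
Hypothesis act_eta : forall g, act g eta = eta.
Hypothesis coef_eta : forall A, coef A eta = (A == set0)%:R.
Hypothesis coef_d : forall A c, A \in F ->
  coef A (d c) = \sum_(v in A) ksgn v A *
    (coef (A :\ v) (act (gen v) c) - coef (A :\ v) c).

Lemma coef0_d c : coef set0 (d c) = 0.
Proof. by rewrite coef_d // big_set0. Qed.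

Lemma coef_linear A a c c' : coef A (a *: c + c') = a * coef A c + coef A c'.
Proof. exact: linearP. Qed.

(* The conjugate of the contraction [s] by [g]. *)
Definition sact g c := act g^-1%g (s (act g c)).

Lemma sact_eta g : sact g eta = 0.
Proof. by rewrite /sact act_eta s_eta linear0. Qed.

Lemma sact_d g c :
  sact g (d c) = c - d (sact g c) - coef set0 (act g c) *: eta.
Proof.
have := contraction (act g c); rewrite -act_d => /(congr1 (act g^-1%g)).
rewrite [act g^-1%g (_ + s _)]linearD [act g^-1%g (_ - _)]linearB linearZ /=.
rewrite act_d -!actM mulgV act1 act_eta -/(sact g c) -/(sact g (d c)) => e.
by rewrite addrAC -e addrC addKr.
Qed.

Lemma act_sact h g c : act h (sact (h * g)%g c) = sact g (act h c).
Proof. by rewrite /sact -!actM invgM mulgVK. Qed.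

(** Contracts successively at every entry but the last, where the coefficient at the empty set is
    read: the comparison map into homogeneous cochains that a contraction provides. *)
Fixpoint psi (l : seq G) (c : K) : rat :=
  if l is g :: l' then
    if l' is [::] then coef set0 (act g c) else psi l' (sact g c)
  else 0.

Lemma psi_cons2 g h l c : psi [:: g, h & l] c = psi (h :: l) (sact g c).
Proof. by []. Qed.

Lemma psi_linear l a c c' : psi l (a *: c + c') = a * psi l c + psi l c'.
Proof.
elim: l c c' => [|g [|h l] IHl] c c'; first by rewrite /= mulr0 addr0.
  by rewrite /= !linearP.
by rewrite !psi_cons2 -IHl /sact !linearP.
Qed.

Lemma psiB l c c' : psi l (c - c') = psi l c - psi l c'.
Proof. by rewrite addrC -scaleN1r psi_linear mulN1r addrC. Qed.

Lemma psi_eta l : (1 < size l)%N -> psi l eta = 0.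
Proof.
case: l => [//|g [//|h l]] _; rewrite psi_cons2 sact_eta.
have := psiB (h :: l) 0 0; rewrite subr0 => ->.
by rewrite subrr.
Qed.

Lemma psi0 l : psi l 0 = 0.
Proof. by have := psiB l 0 0; rewrite subr0 => ->; rewrite subrr. Qed.

Lemma psi_act h l c : psi ([seq (h * k)%g | k <- l]) c = psi l (act h c).
Proof.
elim: l c => [//|g [|k l] IHl] c; first by rewrite /= actM.
rewrite -[LHS]/(psi [seq (h * x)%g | x <- k :: l] (sact (h * g)%g c)).
by rewrite IHl act_sact.
Qed.

(** By [sact_d], [d] moves past one contraction at a time. The correction along [eta] is killed by
    [psi_eta] while two entries remain, and supplies the last term of the coboundary when only one
    does. *)
Lemma ldiff_psi l c : (1 < size l)%N -> ldiff (psi^~ c) l = psi l (d c).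
Proof.
elim: l c => [//|g [//|h [|k l]] IHl] c _.
  rewrite /= subr0 sact_d !linearB !linearZ /= act_d coef0_d act_eta coef_eta.
  by rewrite eqxx subr0 /GRing.scale /= mulrN1.
rewrite [LHS]/= -/(ldiff _ [:: h, k & l]).
rewrite psi_cons2 sact_d !psiB -IHl //.
have -> : psi [:: h, k & l] (coef set0 (act g c) *: eta) = 0.
  by rewrite -[_ *: _]addr0 psi_linear psi_eta // psi0 mulr0 addr0.
by rewrite subr0.
Qed.

Variables (H : groupType) (val : H -> G) (r : G -> H).
Hypothesis valM : forall x y, val (x * y)%g = (val x * val y)%g.
Hypothesis r_equiv : forall x g, r (val x * g)%g = (x * r g)%g.

(* The dual of the chain map from the cubical chains of [G] to the standard
   resolution of [H] that is built with the cone contraction of the latter. *)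
Fixpoint phi n (u : seq H -> rat) (g : G) (A : {set V}) : rat :=
  if n is n'.+1 then cdiff (phi n' (fun l => u (r g :: l))) g A
  else (A == set0)%:R * u [:: r g].

Lemma eq_phi n u u' g A : (forall l, size l = n.+1 -> u l = u' l) ->
  phi n u g A = phi n u' g A.
Proof.
elim: n u u' g A => [|n IHn] u u' g A uu' /=; first by rewrite uu'.
by apply: eq_cdiff => h v _; apply: IHn => l sl; rewrite uu' //= sl.
Qed.

Lemma phiB n u u' g A :
  phi n (fun l => u l - u' l) g A = phi n u g A - phi n u' g A.
Proof.
elim: n u u' g A => [|n IHn] u u' g A /=; first by rewrite mulrBr.
by rewrite -cdiffB; apply: eq_cdiff => h v _; apply: IHn.
Qed.

(** Expanding [ldiff] at the head [r g] gives the desired term and, by induction, a [cdiff] of a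
    [cdiff], which vanishes. *)
Lemma phi_ldiff n u g A : A \in F ->
  phi n.+1 (ldiff u) g A = cdiff (phi n u) g A.
Proof.
elim: n u g A => [|n IHn] u g A AF.
  rewrite -[LHS]/(cdiff (phi 0 (fun l => ldiff u (r g :: l))) g A).
  apply: eq_bigr => v _; rewrite /= !subr0.
  by ring.
rewrite -[LHS]/(cdiff (phi n.+1 (fun l => ldiff u (r g :: l))) g A).
transitivity (cdiff (phi n.+1 u) g A -
  cdiff (phi n.+1 (ldiff (fun m => u (r g :: m)))) g A).
  by rewrite -cdiffB; apply: eq_cdiff => h v _; rewrite -phiB.
have -> : cdiff (phi n.+1 (ldiff (fun m => u (r g :: m)))) g A =
          cdiff (cdiff (phi n (fun m => u (r g :: m)))) g A.
  by apply: eq_cdiff => h v vA; rewrite IHn // FD1.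
by rewrite cdiff_cdiff // subr0.
Qed.

Lemma phi_equiv n u x g A :
  phi n u (val x * g)%g A = phi n (fun l => u ([seq (x * y)%g | y <- l])) g A.
Proof.
elim: n u g A => [|n IHn] u g A /=; first by rewrite r_equiv.
apply: eq_bigr => v _; rewrite -mulgA !IHn r_equiv.
by [].
Qed.

(** The map from [K] to cubical cochains that passes through the standard complex of [H]. It is to
    be compared with the direct map [coef A (act g c)]; [err] is the difference. *)
Let theta n c := phi n (fun l => psi (map val l) c).

Let thetaS n c g A : theta n.+1 c g A = cdiff (theta n (sact (val (r g)) c)) g A.
Proof.
by apply: eq_cdiff => h v _; apply: eq_phi => // -[|? l].
Qed.

Let theta_linear n a c c' g A :
  theta n (a *: c + c') g A = a * theta n c g A + theta n c' g A.
Proof.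
elim: n c c' g A => [|n IHn] c c' g A.
  rewrite /theta -[LHS]/((A == set0)%:R * psi [:: val (r g)] _) psi_linear.
  by rewrite /=; ring.
rewrite !thetaS /cdiff mulr_sumr -big_split /=; apply: eq_bigr => v _.
by rewrite /sact !linearP /= !IHn; ring.
Qed.

Let err c g A := theta #|A| c g A - coef A (act g c).

Let err_linear a c c' g A :
  err (a *: c + c') g A = a * err c g A + err c' g A.
Proof.
by rewrite /err theta_linear (linearP (act g)) coef_linear; ring.
Qed.

Let err_d c g A : A \in F -> err (d c) g A = cdiff (err c) g A.
Proof.
move=> AF; rewrite /err act_d coef_d // [RHS]cdiffB; congr (_ - _); last first.
  by apply: eq_bigr => v _; rewrite actM.
case e: #|A| => [|n].
  move/eqP: e; rewrite cards_eq0 => /eqP ->; rewrite cdiff0.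
  by rewrite /theta /= act_d coef0_d mulr0.
transitivity (phi n.+1 (ldiff (fun l => psi (map val l) c)) g A).
  apply: eq_phi => l sl; rewrite (@ldiff_map _ _ val (psi^~ c)) ldiff_psi //.
  by rewrite size_map sl.
rewrite phi_ldiff //; apply: eq_cdiff => h v vA.
by move: e; rewrite (cardsD1 v) vA add1n => -[->].
Qed.

Let err_eta g A : err eta g A = 0.
Proof.
rewrite /err act_eta coef_eta; case e: #|A| => [|n].
  rewrite /theta /= act_eta coef_eta eqxx mulr1 subrr.
  by [].
have /negPf -> : A != set0 by rewrite -cards_eq0 e.
rewrite subr0 thetaS /cdiff big1 // => v _; rewrite sact_eta.
have t0 h B : theta n 0 h B = 0.
  have := theta_linear n 1 0 0 h B; rewrite scaler0 addr0 mul1r => e0.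
  by lra.
by rewrite !t0 subrr mulr0.
Qed.

(* [err] vanishes up to homotopy because [K] is contractible. *)
Fixpoint hty n (c : K) (g : G) (A : {set V}) : rat :=
  if n is n'.+1 then
    err (sact (val (r g)) c) g A - cdiff (hty n' (sact (val (r g)) c)) g A
  else 0.

Lemma hty_linear n a c c' g A :
  hty n (a *: c + c') g A = a * hty n c g A + hty n c' g A.
Proof.
elim: n c c' g A => [|n IHn] c c' g A /=; first by rewrite mulr0 addr0.
rewrite {1 2}/sact !linearP /= -!/(sact _ _) err_linear.
have -> : cdiff (hty n (a *: sact (val (r g)) c + sact (val (r g)) c')) g A =
  a * cdiff (hty n (sact (val (r g)) c)) g A +
  cdiff (hty n (sact (val (r g)) c')) g A.
  rewrite /cdiff mulr_sumr -big_split /=; apply: eq_bigr => v _.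
  by rewrite !IHn; ring.
by ring.
Qed.

Lemma hty0 n g A : hty n 0 g A = 0.
Proof.
have := hty_linear n 1 0 0 g A; rewrite scaler0 addr0 mul1r => e0.
by lra.
Qed.

(** The index of [hty] is one more than the cardinality of the set at which it is evaluated.
    Expanding [sact] of [d c] by [sact_d] gives [c], a multiple of [eta], which contributes nothing,
    and [d w], whose contributions cancel. *)
Lemma htyE c g A : A \in F ->
  cdiff (hty #|A| c) g A + hty #|A|.+1 (d c) g A = err c g A.
Proof.
move e : #|A| => n; elim: n c g A e => [|n IHn] c g A e AF.
  have A0 : A = set0 by apply/eqP; rewrite -cards_eq0 e.
  rewrite /= A0 !cdiff0 subr0 add0r sact_d.
  rewrite -scaleNr [_ + _ *: eta]addrC err_linear err_eta mulr0 add0r.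
  by rewrite -[_ - _]addrC -scaleN1r err_linear err_d // cdiff0 mulr0 add0r.
set w := sact (val (r g)) c.
(* The induction hypothesis for [w] on the facets of [A], differentiated once more. *)
have errw : cdiff (hty n.+1 (d w)) g A = err (d w) g A.
  transitivity (cdiff (fun g A => err w g A - cdiff (hty n w) g A) g A).
    apply: eq_cdiff => h v vA; rewrite -(IHn w h (A :\ v)) ?FD1 //.
      by rewrite addrAC subrr add0r.
    by move: e; rewrite (cardsD1 v) vA add1n => -[].
  by rewrite cdiffB cdiff_cdiff // subr0 err_d.
have -> : hty n.+2 (d c) g A = err (sact (val (r g)) (d c)) g A -
    cdiff (hty n.+1 (sact (val (r g)) (d c))) g A by [].
rewrite sact_d -/w; set k := coef set0 _.
have -> : c - d w - k *: eta = (- k) *: eta + ((-1) *: d w + c).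
  by rewrite !scaleNr scale1r addrC [- d w + c]addrC.
have -> : cdiff (hty n.+1 ((- k) *: eta + (-1 *: d w + c))) g A =
          - cdiff (hty n.+1 (d w)) g A + cdiff (hty n.+1 c) g A.
  rewrite /cdiff -sumrN -big_split; apply: eq_bigr => v _.
  have hty_eta h B : hty n.+1 eta h B = 0.
    rewrite /= sact_eta /cdiff big1 => [|u _]; last by rewrite !hty0 subrr mulr0.
    have := err_linear 1 0 0 h B; rewrite scaler0 addr0 mul1r => e0.
    by lra.
  rewrite !hty_linear !hty_eta -[RHS]/(_ + _).
  by ring.
rewrite !err_linear err_eta errw; ring.
Qed.

Hypothesis val_act : forall g v w, exists x,
  (g * gen v)%g = (val x * (g * gen w))%g.

(* If the cocycle [psi ^~ c] of [H] bounds, then so does the cochain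
   [coef (act g c)] of the Koszul-type complex of [G], through a cochain that is
   left invariant under [H]; along an orbit of such a cochain, [cdiff] is the
   simplicial coboundary. *)
Lemma coboundary_pairing n c (f : {set V} -> rat) g :
  d c = 0 -> (forall x, act (val x) c = c) ->
  (if n is m.+1 then exists2 u : seq H -> rat,
     forall x l, size l = n -> u [seq (x * y)%g | y <- l] = u l &
     forall l, size l = n.+1 -> psi (map val l) c = ldiff u l
   else forall l, size l = n.+1 -> psi (map val l) c = 0) ->
  (forall y, \sum_(A in F | #|A| == n) f A * sdiff y A = 0) ->
  \sum_(A in F | #|A| == n) f A * coef A (act g c) = 0.
Proof.
move=> dc cH ubd f0.
suff [b bH bE] : exists2 b, forall x g A, b (val x * g)%g A = b g A &
    forall g A, A \in F -> #|A| = n -> coef A (act g c) = cdiff b g A.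
  have [v0|V0] := pickP (fun _ : V => true); last first.
    apply: big1 => A /andP[AF /eqP An]; rewrite bE // /cdiff big1 ?mulr0 // => v.
    by have := V0 v.
  (* All [g * gen v] lie in one orbit of [H], so [gen v0] may replace every [gen v]; then
     [cdiff b g] is [sdiff] of a function of the set alone. *)
  move=> _; rewrite -[RHS](f0 (fun A => b (g * gen v0)%g A - b g A)).
  apply: eq_bigr => A /andP[AF /eqP An]; rewrite bE //; congr (_ * _).
  apply: eq_bigr => v _; have [x ->] := val_act g v v0.
  by rewrite bH.
have errH x c' h A : err c' (val x * h)%g A = err (act (val x) c') h A.
  rewrite /err actM /theta phi_equiv; congr (_ - _); apply: eq_phi => l _.
  rewrite -psi_act -!map_comp; congr (psi _ _).
  by apply: eq_map => y; exact: valM.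
have htyH m x c' h A : hty m c' (val x * h)%g A = hty m (act (val x) c') h A.
  elim: m c' h A => [//|m IHm] c' h A; rewrite /= errH r_equiv valM act_sact.
  congr (_ - _); apply: eq_bigr => v _.
  by rewrite -mulgA !IHm act_sact.
have errE h A : A \in F -> #|A| = n -> err c h A = cdiff (hty n c) h A.
  by move=> AF An; rewrite -htyE // dc hty0 addr0 An.
case: n ubd {f0} errE => [|n] ubd errE.
  exists (fun _ _ => 0) => // h A AF An; rewrite /cdiff big1.
    have A0 : A = set0 by apply/eqP; rewrite -cards_eq0 An.
    have := errE h A AF An; rewrite A0 cdiff0 /err cards0 /theta /=.
    have -> : coef set0 (act (val (r h)) c) = 0 by apply: (ubd [:: r h]).
    by move=> e; lra.
  by move=> v _; rewrite subrr mulr0.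
case: ubd => u uH uE.
(* [coef A (act g c)] is [theta] minus [err]; the former bounds through [phi n u], the latter
   through [hty]. *)
exists (fun g A => phi n u g A - hty n.+1 c g A) => [y h B|h B AF An].
  rewrite htyH cH phi_equiv; congr (_ - _); apply: eq_phi => l sl; exact: uH.
rewrite cdiffB -errE // -phi_ldiff // /err An.
have -> : theta n.+1 c h B = phi n.+1 (ldiff u) h B.
  by apply: eq_phi => l sl; rewrite uE.
by rewrite opprB addrC subrK.
Qed.
End Comparison.

(** * The Koszul complex of the trace monoid *)

Arguments adjacent : simpl never.

Section Faces.
Variables (V : finType) (D : {set {set V}}).
Hypotheses (scD : simplicial_complex D) (flagD : flag D).
Implicit Types (v w a : V) (A : {set V}).

Definition faces := set0 |: D.

Lemma set0_face : set0 \in faces.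
Proof. by rewrite !inE eqxx. Qed.

Lemma sub_face A B : B \in faces -> A \subset B -> A \in faces.
Proof.
case: scD => _ _ subD; rewrite !inE => BF AB; have [//|A0] := eqVneq A set0.
case/orP: BF => [/eqP B0|BD]; last exact: subD AB _.
by rewrite B0 subset0 (negPf A0) in AB.
Qed.

Lemma faceD1 A v : A \in faces -> v \in A -> A :\ v \in faces.
Proof. by move=> AF _; apply: sub_face AF (subD1set _ _). Qed.

Lemma adjacentC v w : adjacent D v w = adjacent D w v.
Proof. by rewrite /adjacent eq_sym setUC. Qed.

Lemma face_adjacent A v w :
  A \in faces -> v \in A -> w \in A -> v != w -> adjacent D v w.
Proof.
move=> AF vA wA vw; rewrite /adjacent vw.
have: [set v; w] \in faces.
  by apply: sub_face AF _; rewrite subUset !sub1set vA.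
rewrite !inE => /orP[/eqP e|//].
by have := set21 v w; rewrite e inE.
Qed.

Lemma faceU1 a A :
  A \in faces -> {in A, forall v, adjacent D a v} -> a |: A \in faces.
Proof.
move=> AF aA; rewrite inE; apply/orP; right; apply: flagD.
  by apply/set0Pn; exists a; rewrite setU11.
move=> v w; rewrite !inE => /orP[/eqP->|vA] /orP[/eqP->|wA] vw.
- by rewrite eqxx in vw.
- exact: aA.
- by rewrite adjacentC aA.
- exact: (face_adjacent AF).
Qed.

Lemma pres_gen_comm v w : adjacent D v w ->
  (pres_gen (raag_relator D) v * pres_gen (raag_relator D) w =
   pres_gen (raag_relator D) w * pres_gen (raag_relator D) v)%g.
Proof.
move=> vw; rewrite -[LHS]pi_pres_mul -[RHS]pi_pres_mul; apply/eqP/presentedP.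
(* Inserting two cancelling pairs turns [v w] into the relator followed by [w v]. *)
have e1 := @pres_cancel _ (raag_relator D) [:: (v, true); (w, true)] (v, false) [::].
have e2 := @pres_cancel _ (raag_relator D)
  [:: (v, true); (w, true); (v, false)] (w, false) [:: (v, true)].
have e3 := @pres_relator _ (raag_relator D) [::] _ [:: (w, true); (v, true)]
  (ex_intro _ v (ex_intro _ w (conj vw erefl))).
apply: pres_trans (pres_trans (pres_sym e1) (pres_sym e2)) _.
exact: e3.
Qed.

Lemma face_gen_comm A : A \in faces ->
  {in A &, forall v w,
    (pres_gen (raag_relator D) v * pres_gen (raag_relator D) w =
     pres_gen (raag_relator D) w * pres_gen (raag_relator D) v)%g}.
Proof.
move=> AF v w vA wA; have [->//|vw] := eqVneq v w.
exact/pres_gen_comm/(face_adjacent AF).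
Qed.

End Faces.

Section Koszul.
Variables (V : finType) (D : {set {set V}}).
Hypotheses (scD : simplicial_complex D) (flagD : flag D).
Variable N : nat.

Local Notation F := (faces D).
Local Notation adj := (adjacent D).
Implicit Types (v a : V) (w x y : seq V) (A : {set V}).

Definition wcochain := seq V -> {set V} -> rat^o.
HB.instance Definition _ := GRing.Lmodule.on wcochain.
Implicit Types f : wcochain.

(* The head of a word is its last letter as an element of the trace monoid:
   [v :: w] stands for [w v] and [rcons w v] for [v w]. *)
Definition kgood_spec f : Prop :=
  (forall A x y a b, adj a b ->
     f (x ++ [:: a, b & y]) A = f (x ++ [:: b, a & y]) A) /\
  (forall w A, ~~ ((A \in F) && (size w + #|A| <= N)%N) -> f w A = 0).

Definition kgood : pred wcochain := fun f => `[< kgood_spec f >].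

Lemma kgood_closed : submod_closed kgood.
Proof.
split=> [|r f g /asboolP[i1 s1] /asboolP[i2 s2]]; apply/asboolP; split=> //.
  by move=> A x y a b ab; rewrite !fctE /= i1 // i2.
by move=> w A h; rewrite !fctE /= s1 // s2 // scaler0 addr0.
Qed.

(** Functions on pairs of a trace and a clique, cut off at total length [N]. The cutoff is
    compatible with the differential and makes translation by a letter nilpotent, so that generators
    act invertibly. *)
Definition koszul := {f : wcochain | kgood f}.
HB.instance Definition _ := SubChoice.on koszul.
HB.instance Definition _ := GRing.SubChoice_isSubLmodule.Build rat
  wcochain kgood koszul kgood_closed.

Section Lift.
Variables (T : wcochain -> wcochain) (linT : linear T).
Variable goodT : forall f, kgood f -> kgood (T f).

Definition klift (c : koszul) : koszul := Sub (T (val c)) (goodT (valP c)).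

Lemma klift_linear : linear klift.
Proof.
move=> r f g; apply: val_inj.
by rewrite [RHS]linearP -[LHS]/(T (val (r *: f + g))) linearP linT.
Qed.

HB.instance Definition _ :=
  GRing.isLinear.Build rat koszul koszul _ klift klift_linear.

Definition klin : {linear koszul -> koszul} := klift.

End Lift.

Definition kd f : wcochain := fun w A =>
  (A \in F)%:R * \sum_(v in A) ksgn v A * f (v :: w) (A :\ v).

Fixpoint is_last a w : bool :=
  if w is b :: w' then (a == b) || adj a b && is_last a w' else false.

(* The letters that can stand last in the trace obtained from [w] by appending
   the clique [A]. *)
Definition toggle w A : pred V := fun a =>
  (a \in A) || is_last a w && [forall v in A, adj a v].

(** The picked letter matches [(w, A)] with the pair obtained by moving that letter between [w] and
    [A]; [ks] is supported on the half of the matching where it lies outside [A]. *)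
Definition ks f : wcochain := fun w A =>
  if [pick a | toggle w A a] is Some a then
    if a \in A then 0 else ksgn a A * f (rem a w) (a |: A)
  else 0.

(* [v] acts as [1 + L] with [L] the left translation by [v], and [v^-1] as the
   geometric series of [- L], which stops since [L ^ N.+1 = 0]. *)
Definition kop (l : V * bool) f : wcochain := fun w A =>
  if l.2 then f w A + f (rcons w l.1) A
  else \sum_(k < N.+1) (-1) ^+ k * f (w ++ nseq k l.1) A.

Definition kops (u : word V) f : wcochain := foldl (fun f l => kop l f) f u.

Lemma wcochainE r f g w A :
  (r *: f + g : wcochain) w A = r * f w A + g w A :> rat.
Proof. by []. Qed.

Lemma kd_linear : linear kd.
Proof.
move=> r f g; apply/funext=> w; apply/funext=> A.
rewrite wcochainE /kd mulrCA -mulrDr; congr (_ * _).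
rewrite mulr_sumr -big_split /=; apply: eq_bigr => v _.
by rewrite wcochainE mulrDr mulrCA.
Qed.

Lemma ks_linear : linear ks.
Proof.
move=> r f g; apply/funext=> w; apply/funext=> A; rewrite wcochainE /ks.
case: pickP => [a _|_]; last by rewrite mulr0 addr0.
case: (a \in A); first by rewrite mulr0 addr0.
by rewrite wcochainE mulrDr mulrCA.
Qed.

Lemma kop_linear l : linear (kop l).
Proof.
move=> r f g; apply/funext=> w; apply/funext=> A; rewrite wcochainE /kop.
case: l.2; first by rewrite !wcochainE mulrDr addrACA.
rewrite mulr_sumr -big_split /=; apply: eq_bigr => k _.
by rewrite wcochainE mulrDr mulrCA.
Qed.

Lemma kops_linear u : linear (kops u).
Proof.
move=> r f g; rewrite /kops; elim: u f g => //= l u IHu f g.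
by rewrite kop_linear IHu.
Qed.

Lemma kd_good f : kgood f -> kgood (kd f).
Proof.
move=> /asboolP[i s]; apply/asboolP; split=> [A x y a b ab|w A].
  by congr (_ * _); apply: eq_bigr => v _; congr (_ * _); apply: (i _ (v :: x)).
rewrite /kd; case: (boolP (A \in F)) => AF /=; last by rewrite mul0r.
move=> wN; rewrite mul1r big1 // => v vA; rewrite s ?mulr0 //.
rewrite (faceD1 scD) //=; apply: contra wN.
by rewrite (cardsD1 v A) vA /= addSnnS.
Qed.

Lemma is_last_swap c x y a b : adj a b ->
  is_last c (x ++ [:: a, b & y]) = is_last c (x ++ [:: b, a & y]).
Proof.
move=> ab; elim: x => [|e x IHx] /=; last by rewrite IHx.
have [->|ca] := eqVneq c a; first by rewrite ab /= orbT.
have [->|cb] /= := eqVneq c b; first by rewrite adjacentC ab.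
by rewrite andbCA.
Qed.

Lemma is_last_mem a w : is_last a w -> a \in w.
Proof.
elim: w => //= b w IHw /orP[/eqP->|/andP[_ /IHw]]; first exact: mem_head.
by rewrite inE => ->; rewrite orbT.
Qed.

Lemma rem_swap f A c x y a b : kgood f -> adj a b ->
  f (rem c (x ++ [:: a, b & y])) A = f (rem c (x ++ [:: b, a & y])) A.
Proof.
move=> /asboolP[i _] ab.
elim: x f i => [|e x IHx] f i /=.
  have [->|ac] := eqVneq a c; have [bc|bc] := eqVneq b c => //=.
  - by rewrite -bc.
  - exact: (i _ [::]).
have [_|_] := eqVneq e c; first exact: i.
apply: (IHx (fun w A => f (e :: w) A)) => B x' y' a' b' ab'.
exact: (i B (e :: x')).
Qed.

(** [rem] deletes the occurrence nearest the head, and [is_last] says that exactly this one commutes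
    to the head. *)
Lemma is_last_rem f A a w : kgood f -> is_last a w -> f (a :: rem a w) A = f w A.
Proof.
move=> /asboolP[i _]; elim: w f i => //= b w IHw f i.
have [->//|ab] /= := eqVneq a b => /andP[adj_ab aw].
rewrite (i _ [::]) //.
apply: (IHw (fun w A => f (b :: w) A)) => // B x y c e ce.
exact: (i B (b :: x)).
Qed.

Lemma toggle_swap A x y a b : adj a b ->
  toggle (x ++ [:: a, b & y]) A =1 toggle (x ++ [:: b, a & y]) A.
Proof. by move=> ab c; rewrite /toggle is_last_swap. Qed.

(** The product of [w] and [A] is unchanged when [v] passes from [A] to [w]. Hence all terms of [kd]
    at [(w, A)] pick the same letter. *)
Lemma toggleD1 v w A : A \in F -> v \in A ->
  toggle (v :: w) (A :\ v) =1 toggle w A.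
Proof.
move=> AF vA a; rewrite /toggle /= !inE.
have [->|av] /= := eqVneq a v.
  rewrite vA; apply/forall_inP => u; rewrite !inE => /andP[uv uA].
  by apply: (face_adjacent scD AF); rewrite // eq_sym.
suff -> : [forall u in A, adj a u] = adj a v && [forall u in A :\ v, adj a u].
  by rewrite [is_last a w && _]andbCA andbA.
apply/forall_inP/idP => [h|/andP[adj_av /forall_inP h] u uA].
  rewrite h //=; apply/forall_inP => u; rewrite !inE => /andP[_].
  exact: h.
by have [->//|uv] := eqVneq u v; apply: h; rewrite !inE uv.
Qed.

Lemma ks_good f : kgood f -> kgood (ks f).
Proof.
move=> gf; apply/asboolP; split=> [A x y a b ab|w A].
  rewrite /ks (eq_pick (toggle_swap _ _ _ ab)); case: pickP => // c _.
  by case: (c \in A) => //; rewrite (rem_swap _ _ _ _ gf ab).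
have /asboolP[_ s] := gf; rewrite /ks; case: pickP => // a.
rewrite /toggle; case: (boolP (a \in A)) => //= aA /andP[aw _] wN.
rewrite s ?mulr0 //; apply: contra wN => /andP[aAF].
rewrite (sub_face scD aAF (subsetUr _ _)) /= cardsU1 aA.
rewrite size_rem; last exact: is_last_mem.
by case: w aw => //= *; lia.
Qed.

Lemma kop_good l f : kgood f -> kgood (kop l f).
Proof.
move=> /asboolP[i s]; apply/asboolP; split=> [A x y a b ab|w A wN];
  rewrite /kop; case: l.2.
- by rewrite (i A x y a b ab) !rcons_cat /= (i A x (rcons y l.1) a b ab).
- by apply: eq_bigr => k _; rewrite -!catA /= (i A x (y ++ nseq k l.1) a b ab).
- rewrite s // s ?addr0 //; apply: contra wN => /andP[-> /=].
  by rewrite size_rcons; lia.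
- rewrite big1 // => k _; rewrite s ?mulr0 //; apply: contra wN => /andP[-> /=].
  by rewrite size_cat size_nseq; lia.
Qed.

Lemma kops_good u f : kgood f -> kgood (kops u f).
Proof. by elim: u f => //= l u IHu f gf; apply/IHu/kop_good. Qed.

Lemma kgood_eq0 f w A : kgood f -> (N < size w)%N -> f w A = 0 :> rat.
Proof.
move=> /asboolP[_ s] Nw; rewrite s // negb_and -ltnNge orbC.
by rewrite (leq_trans Nw) ?leq_addr.
Qed.

Lemma alternating_telescope (x : nat -> rat) n :
  \sum_(k < n.+1) (-1) ^+ k * (x k + x k.+1) = x 0 + (-1) ^+ n * x n.+1.
Proof.
elim: n => [|n IHn]; first by rewrite big_ord1 expr0 !mul1r.
by rewrite big_ord_recr IHn /= exprS; ring.
Qed.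

Lemma kopK l f : kgood f -> kop (inv_letter l) (kop l f) = f.
Proof.
move=> gf; apply/funext=> w; apply/funext=> A.
have tel v : \sum_(k < N.+1) (-1) ^+ k *
    (f (w ++ nseq k v) A + f (w ++ nseq k.+1 v) A) = f w A.
  rewrite (alternating_telescope (fun k => f (w ++ nseq k v) A)) cats0.
  rewrite [f (_ ++ nseq N.+1 v) A](kgood_eq0 _ gf) ?mulr0 ?addr0 //.
  by rewrite size_cat size_nseq leq_addl.
case: l => v [] /=; rewrite /kop /=.
  rewrite -[RHS](tel v); apply: eq_bigr => k _.
  by rewrite -cats1 -catA -(nseqD k 1) addn1.
rewrite -[RHS](tel v) -big_split; apply: eq_bigr => k _ /=.
by rewrite cat_rcons -mulrDr.
Qed.

Lemma kop_comm v v' f : kgood f -> adj v v' ->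
  kop (v, true) (kop (v', true) f) = kop (v', true) (kop (v, true) f).
Proof.
move=> /asboolP[i _] vv'; apply/funext=> w; apply/funext=> A; rewrite /kop /=.
have -> : f (rcons (rcons w v) v') A = f (rcons (rcons w v') v) A.
  by rewrite -!cats1 -!catA; exact: i.
by rewrite addrACA.
Qed.

Lemma kops_cat u u' f : kops (u ++ u') f = kops u' (kops u f).
Proof. by rewrite /kops foldl_cat. Qed.

(** The relations hold among the operators, so the action of words descends to the group. *)
Lemma kops_eqv u u' f : pres_eqv (raag_relator D) u u' -> kgood f ->
  kops u f = kops u' f.
Proof.
move=> uu'; elim: uu' f => {u u'}
  [//|u u' _ IH|u1 u2 u3 _ IH1 _ IH2|u l u'|u r u' [v [v' [vv' ->]]]] f.
- by move=> /IH ->.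
- by move=> gf; rewrite IH1 // IH2.
- move=> gf; have := kops_good u gf; rewrite !kops_cat.
  by move: (kops u f) => g gg; congr kops; exact: kopK.
- move=> gf; have := kops_good u gf; rewrite !kops_cat.
  move: (kops u f) => g gg; congr kops.
  rewrite -[LHS]/(kop (v', false) (kop (v, false)
    (kop (v', true) (kop (v, true) g)))).
  rewrite kop_comm ?(adjacentC _ v') //.
  by rewrite (kopK (v, true)) ?kop_good // (kopK (v', true)).
Qed.

Lemma kop_kd l f : kop l (kd f) = kd (kop l f).
Proof.
apply/funext=> w; apply/funext=> A; rewrite /kop /kd; case: l => v [] /=.
  rewrite -mulrDr -big_split; congr (_ * _); apply: eq_bigr => a _ /=.
  by rewrite mulrDr.
under eq_bigr do rewrite mulrCA.
rewrite -mulr_sumr; congr (_ * _).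
under eq_bigr do rewrite mulr_sumr.
rewrite exchange_big; apply: eq_bigr => a _ /=.
by rewrite mulr_sumr; apply: eq_bigr => k _; rewrite mulrCA.
Qed.

Lemma kops_kd u f : kops u (kd f) = kd (kops u f).
Proof. by elim: u f => //= l u IHu f; rewrite kop_kd IHu. Qed.

Definition keta_fun : wcochain := fun w A => ((w == [::]) && (A == set0))%:R.

Lemma keta_good : kgood keta_fun.
Proof.
apply/asboolP; split=> [A x y a b _|w A]; first by case: x.
rewrite /keta_fun; case: eqP => [->|//] /=; case: eqP => [->|//].
by rewrite (set0_face D) cards0.
Qed.

Lemma kop_eta l : kop l keta_fun = keta_fun.
Proof.
have eta_true v : kop (v, true) keta_fun = keta_fun.
  apply/funext=> w; apply/funext=> A; rewrite /kop /keta_fun /=.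
  by case: w => [|? ?]; rewrite /= addr0.
case: l => v [] //; rewrite -{1}(eta_true v).
exact: (kopK (v, true) keta_good).
Qed.

Lemma kops_eta u : kops u keta_fun = keta_fun.
Proof. by elim: u => //= l u IHu; rewrite kop_eta. Qed.

Lemma ks_eta : ks keta_fun = 0.
Proof.
apply/funext=> w; apply/funext=> A; rewrite /ks /keta_fun /=.
case: pickP => // a _; case: (a \in A) => //.
suff /negPf -> : a |: A != set0 by rewrite andbF mulr0.
by apply/set0Pn; exists a; rewrite setU11.
Qed.

Lemma ks_contraction f : kgood f ->
  kd (ks f) + ks (kd f) = f - f [::] set0 *: keta_fun.
Proof.
move=> gf; have /asboolP[_ supp] := gf; apply/funext=> w; apply/funext=> A.
rewrite -[LHS]/(kd (ks f) w A + ks (kd f) w A).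
rewrite -[RHS]/(f w A - f [::] set0 * keta_fun w A).
have [AF|AF] := boolP (A \in F); last first.
  have -> : f w A = 0 by rewrite supp // (negPf AF).
  have /negPf A0 : A != set0 by apply: contraNneq AF => ->; exact: set0_face.
  rewrite /keta_fun A0 andbF mulr0 subr0 /kd (negPf AF) mul0r add0r /ks.
  case: pickP => // a _; case: (a \in A) => //.
  have /negPf -> : a |: A \notin F.
    by apply: contra AF => aAF; apply: (sub_face scD aAF); exact: subsetUr.
  by rewrite mul0r mulr0.
have kdE (g : wcochain) B x : B \in F ->
    kd g x B = \sum_(v in B) ksgn v B * g (v :: x) (B :\ v).
  by move=> BF; rewrite /kd BF mul1r.
rewrite kdE // [ks (kd f) w A]/ks; case pk: [pick a | toggle w A a] => [a|].
  have ksD1 v : v \in A -> ks f (v :: w) (A :\ v) = if a \in A :\ v then 0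
      else ksgn a (A :\ v) * f (rem a (v :: w)) (a |: (A :\ v)).
    by move=> vA; rewrite /ks (eq_pick (toggleD1 _ AF vA)) pk.
  have: toggle w A a by move: pk; case: pickP => // b tb [<-].
  (* If [a] lies in [A], then [ks (kd f)] vanishes here and only the summand [v = a] of [kd (ks f)]
     survives. *)
  have [aA _|aA] := boolP (a \in A).
    have -> : keta_fun w A = 0.
      by rewrite /keta_fun; case: eqP aA => [_|]; case: eqP => // ->; rewrite inE.
    rewrite mulr0 subr0 addr0 (bigD1 a) //= big1 ?addr0 => [|v /andP[vA va]].
      rewrite ksD1 // !inE eqxx /= eqxx setD1K // ksgnD1 mulrA ksgnK.
      by rewrite mul1r.
    by rewrite ksD1 // !inE aA eq_sym va mulr0.
  rewrite /toggle (negPf aA) /= => /andP[aw /forall_inP adj_a].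
  (* If [a] lies in [w], the summand of [ks (kd f)] that moves [a] back restores [f w A]; the others
     cancel against [kd (ks f)] by [ksgn_swap]. *)
  have aAF : a |: A \in F by apply: faceU1.
  have -> : keta_fun w A = 0 by case: (w) aw.
  rewrite mulr0 subr0 kdE // big_setU1 //= mulrDr mulrA ksgnU1 // ltnn.
  rewrite expr0 mul1r ksgnK mul1r setU1K // is_last_rem // addrCA.
  rewrite mulr_sumr -big_split big1 ?addr0 // => v vA /=.
  have va : v != a by apply: contraNneq aA => <-.
  rewrite ksD1 // !inE (negPf aA) andbF /= (negPf va).
  have -> : (a |: A) :\ v = a |: (A :\ v).
    apply/setP=> u; rewrite !inE.
    by case: (eqVneq u a) => [->|]; rewrite // eq_sym va.
  by rewrite !mulrA ksgn_swap //; ring.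
(* No letter can be moved, so the trace is trivial: the one place where [eta] is non-zero. *)
have A0 : A = set0.
  apply/eqP; rewrite -subset0; apply/subsetP => a aA.
  by move: pk; case: pickP => // /(_ a); rewrite /toggle aA.
have w0 : w = [::].
  case: w pk => // a w; case: pickP => // /(_ a).
  rewrite /toggle A0 inE /= eqxx /= => /negbT/forall_inPn[v].
  by rewrite inE.
by rewrite A0 w0 big_set0 /keta_fun !eqxx mulr1 [RHS]subrr; exact: addr0.
Qed.

End Koszul.

(** * The Koszul complex as a module over the right-angled Artin group *)

Section KoszulModule.
Variables (V : finType) (D : {set {set V}}).
Hypotheses (scD : simplicial_complex D) (flagD : flag D).
Variable N : nat.

Local Notation F := (faces D).
Local Notation G := (presented (raag_relator D)).
Local Notation K := (koszul D N).
Local Notation gen := (pres_gen (raag_relator D)).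
Implicit Types (c : K) (g h : G).

Definition kdiff : {linear K -> K} := klin (kd_linear D) (kd_good scD (N := N)).
Definition kcontr : {linear K -> K} := klin (ks_linear D) (ks_good scD (N := N)).
Definition kact (g : G) : {linear K -> K} :=
  klin (@kops_linear _ N (repr g)) (@kops_good _ D N (repr g)).
Definition keta : K := Sub (@keta_fun V) (keta_good D N).

Definition kcoef_fun A c : rat^o := val c [::] A.

Lemma kcoef_linear A : linear (kcoef_fun A).
Proof. by move=> r c c'; rewrite /kcoef_fun linearP. Qed.

HB.instance Definition _ A :=
  GRing.isLinear.Build rat K rat^o _ (kcoef_fun A) (@kcoef_linear A).

Definition kcoef A : {linear K -> rat^o} := kcoef_fun A.

Lemma raag_pi_cat (u u' : word V) :
  (\pi_G u * \pi_G u')%g = \pi_G (u ++ u') :> G.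
Proof. exact/esym/pi_pres_mul. Qed.

Lemma val_kact u c : val (kact (\pi_G u) c) = kops N u (val c).
Proof.
apply: kops_eqv (valP c).
by apply/presentedP; rewrite reprK.
Qed.

Lemma kactM g h c : kact (g * h)%g c = kact h (kact g c).
Proof.
apply: val_inj; rewrite -[g]reprK -[h]reprK raag_pi_cat.
by rewrite !val_kact kops_cat.
Qed.

Lemma kact1 c : kact 1%g c = c.
Proof.
apply: val_inj; have -> : 1%g = \pi_G [::].
  exact: (piE (pi_pres_one_morph (raag_relator D))).
by rewrite val_kact.
Qed.

Lemma val_kact_gen v c : val (kact (gen v) c) = kop N (v, true) (val c).
Proof. exact: val_kact. Qed.

Lemma kact_d g c : kact g (kdiff c) = kdiff (kact g c).
Proof. apply: val_inj; exact: kops_kd. Qed.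

Lemma kcontraction c :
  kdiff (kcontr c) + kcontr (kdiff c) = c - kcoef set0 c *: keta.
Proof.
apply: val_inj.
exact: (ks_contraction scD flagD (valP c)).
Qed.

Lemma kcontr_eta : kcontr keta = 0.
Proof. apply: val_inj; exact: ks_eta. Qed.

Lemma kact_eta g : kact g keta = keta.
Proof. apply: val_inj; exact: (kops_eta D). Qed.

Lemma kcoef_eta A : kcoef A keta = (A == set0)%:R.
Proof. by []. Qed.

Lemma kcoef_d A c : A \in F ->
  kcoef A (kdiff c) = \sum_(v in A) ksgn v A *
    (kcoef (A :\ v) (kact (gen v) c) - kcoef (A :\ v) c).
Proof.
move=> AF; rewrite -[LHS]/(kd D (val c) [::] A) /kd AF mul1r.
apply: eq_bigr => v _; congr (_ * _).
rewrite -[kcoef _ (kact _ _)]/(val (kact (gen v) c) [::] (A :\ v)) val_kact_gen.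
by rewrite /kop /= addrC addKr.
Qed.

End KoszulModule.

(** * The Bestvina-Brady group *)

Section Height.
Variables (V : finType) (D : {set {set V}}) (t : V).
Implicit Types (g h : raag D) (x : bb D).

Local Notation gen := (pres_gen (raag_relator D) : V -> raag D).

Lemma heightD g h : height (g * h)%g = (height g : int) + (height h : int) :> int.
Proof. exact: heightM. Qed.

Lemma height1 : height (1%g : raag D) = 0 :> int.
Proof. by have := heightD 1%g 1%g; rewrite mulg1 => e; lia. Qed.

Lemma heightV g : height g^-1%g = - (height g : int) :> int.
Proof. by have := heightD g g^-1%g; rewrite mulgV height1 => e; lia. Qed.

Lemma height_expg v n : height (gen v ^+ n)%g = n%:Z :> int.
Proof.
elim: n => [|n IHn]; first exact: height1.
by rewrite expgS heightD IHn height_gen; lia.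
Qed.

Lemma height_bb x : height (val x) = 0 :> int.
Proof. exact/eqP/(valP x). Qed.

Definition bb_of g (hg : height g = 0 :> int) : bb D := Sub g (introT eqP hg).

Definition level_rep (m : int) : raag D :=
  match m with Posz n => (gen t ^+ n)%g | Negz n => (gen t ^+ n.+1)^-1%g end.

Lemma height_level_rep m : height (level_rep m) = m :> int.
Proof.
by case: m => n; rewrite /level_rep ?heightV height_expg ?NegzE.
Qed.

Lemma height_retract g : height (g * (level_rep (height g))^-1)%g = 0 :> int.
Proof. by rewrite heightD heightV height_level_rep subrr. Qed.

(** The power of [t] is divided out on the right, so the retraction commutes with left
    multiplication by the kernel. *)
Definition bb_retract g : bb D := bb_of (height_retract g).

Lemma bb_retractM x g : bb_retract (val x * g)%g = (x * bb_retract g)%g.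
Proof.
apply: val_inj; rewrite valM /= mulgA; congr (_ * (level_rep _)^-1)%g.
by rewrite [LHS]heightD height_bb add0r.
Qed.

Lemma bb_translate g v w :
  exists x, (g * gen v)%g = (val x * (g * gen w))%g.
Proof.
have hx : height (g * gen v * (g * gen w)^-1)%g = 0 :> int.
  by rewrite heightD heightV !heightD !height_gen subrr.
by exists (bb_of hx); rewrite /= mulgVK.
Qed.

Definition const_word (u : word V) : word V := [seq (t, l.2) | l <- u].

Lemma pi_const_word u :
  (\pi_(raag D) (const_word u) * gen t ^+ count (fun l => ~~ l.2) u =
   gen t ^+ count snd u)%g.
Proof.
have pi_cons l w : \pi_(raag D) (l :: w) =
    ((if l.2 then gen l.1 else (gen l.1)^-1) * \pi_(raag D) w)%g.
  rewrite -cat1s -[LHS](raag_pi_cat D); congr (_ * _)%g.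
  case: l => v [] //=; apply/esym.
  by rewrite -[LHS](pi_pres_inv (raag_relator D)).
elim: u => [|l u IHu].
  rewrite /= mulg1.
  exact/esym/(piE (pi_pres_one_morph (raag_relator D))).
rewrite /= -/(const_word u) pi_cons -mulgA /=; case: l.2 => /=.
  by rewrite !add0n IHu add1n expgS.
by rewrite add1n add0n expgSr [X in (_ * X)%g]mulgA IHu -expgSr expgS mulKg.
Qed.

(** The height does not see which generators occur, so a word of height zero has as many positive as
    negative letters, and the corresponding powers of [t] cancel. *)
Lemma pi_const_word_eq1 u :
  height (\pi_(raag D) u) = 0 :> int -> \pi_(raag D) (const_word u) = 1%g.
Proof.
have hE : height (\pi_(raag D) u) = height (\pi_(raag D) (const_word u)) :> int.
  rewrite /height !(pres_lift_pi (@height_relator V D)) /word_eval.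
  by rewrite big_map; apply: eq_bigr => l _.
rewrite hE => h0; have /(congr1 (fun g => height g : int)) := pi_const_word u.
rewrite heightD !height_expg h0 add0r => -[e].
by have := pi_const_word u; rewrite e -[RHS]mul1g => /mulIg.
Qed.

End Height.

(** * Cochains that depend only on the length of the trace *)

Section Radial.
Variables (V : finType) (D : {set {set V}}) (N : nat) (t : V).
Implicit Types f : wcochain V.

Definition radial f := forall w w' A, size w = size w' -> f w A = f w' A.

Lemma kop_radial l f : radial f -> radial (kop N l f).
Proof.
move=> rf w w' A ww'; rewrite /kop; case: l.2.
  by rewrite (rf w w') // (rf (rcons w _) (rcons w' l.1)) // !size_rcons ww'.
apply: eq_bigr => k _; congr (_ * _); apply: rf.
by rewrite !size_cat ww'.
Qed.

Lemma kop_radialE v v' b f : radial f -> kop N (v, b) f = kop N (v', b) f.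
Proof.
move=> rf; apply/funext=> w; apply/funext=> A; rewrite /kop; case: b => /=.
  by rewrite (rf (rcons w v) (rcons w v')) // !size_rcons.
apply: eq_bigr => k _; congr (_ * _); apply: rf.
by rewrite !size_cat !size_nseq.
Qed.

Lemma kops_const_word u f : radial f -> kops N (const_word t u) f = kops N u f.
Proof.
elim: u f => //= -[v b] u IHu f rf.
by rewrite (kop_radialE t v b rf) IHu //; exact: kop_radial.
Qed.

(** All generators act alike on radial functions, so [x] acts as a word in [t] alone, which is
    trivial by height. *)
Lemma kact_bb_radial (x : bb D) (c : koszul D N) :
  radial (val c) -> kact N (val x) c = c.
Proof.
move=> rc; apply: val_inj; rewrite -[LHS]/(kops N (repr (val x)) (val c)).
rewrite -(kops_const_word _ rc) -val_kact pi_const_word_eq1 ?kact1 //.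
by rewrite [X in height X]reprK; exact: height_bb.
Qed.

End Radial.

(** * Infinitely many cohomology classes *)

Section FiniteDimension.

Lemma finite_dim_dependent (k : fieldType) (M : lmodType k) :
  finite_dim M -> exists L, forall y : 'I_L.+1 -> M,
    exists2 a : 'I_L.+1 -> k, exists i, a i != 0 & \sum_i a i *: y i = 0.
Proof.
move=> [s gen_s]; exists (size s) => y.
have [a aE] := choice (fun i => gen_s (y i)).
pose A := \matrix_(i < (size s).+1, j < size s) a i j.
have : kermx A != 0.
  rewrite -mxrank_eq0 mxrank_ker -lt0n subn_gt0.
  exact: leq_ltn_trans (rank_leq_col A) _.
move=> /rowV0Pn[b /sub_kermxP bA b0].
have [i bi] := rV0Pn _ b0.
exists (b 0) => [|]; first by exists i.
under eq_bigr do rewrite aE scaler_sumr.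
rewrite exchange_big big1 // => j _ /=.
under eq_bigr do rewrite scalerA.
rewrite -scaler_suml; have /rowP/(_ j) := bA; rewrite !mxE => e.
rewrite (_ : \sum_i _ = 0) ?scale0r // -[RHS]e.
by apply: eq_bigr => l _; rewrite mxE.
Qed.

End FiniteDimension.

(** * Translation between cochains on tuples and on lists *)

Section OrdinalCochains.
Variable H : groupType.
Implicit Types (l : seq H).

Definition of_list n (u : seq H -> rat) : cochain rat H n :=
  fun x => u [seq x i | i <- enum 'I_n.+1].

Definition to_list n (b : cochain rat H n) (l : seq H) : rat :=
  b (fun i => nth 1%g l i).

Lemma of_listK u n l : size l = n.+1 -> to_list (@of_list n u) l = u l.
Proof.
move=> sl; congr u; apply: (@eq_from_nth _ 1%g).
  by rewrite size_map size_enum_ord sl.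
move=> i; rewrite size_map size_enum_ord => ilt.
rewrite (nth_map ord0) ?size_enum_ord //; congr nth.
by rewrite nth_enum_ord.
Qed.

Lemma to_listE n (b : cochain rat H n) x :
  b x = to_list b [seq x i | i <- enum 'I_n.+1].
Proof.
congr b; apply/funext=> i.
by rewrite (nth_map ord0) ?size_enum_ord // nth_ord_enum.
Qed.

Lemma to_list_cobound n (b : cochain rat H n) l : size l = n.+2 ->
  to_list (cobound b) l = ldiff (to_list b) l.
Proof.
move=> sl; rewrite ldiffE sl; apply: eq_bigr => i _; congr (_ * b _).
apply/funext=> j; rewrite /= nth_cat size_take sl ltn_ord /bump.
case: ltnP => ij; first by rewrite nth_take.
by rewrite nth_drop; congr nth; move: ij; lia.
Qed.

End OrdinalCochains.

(** * Cocycles of the Bestvina-Brady group and the pairing that detects them *)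

Section Detection.
Variables (V : finType) (D : {set {set V}}).
Hypotheses (scD : simplicial_complex D) (flagD : flag D).
Variable t : V.
Local Notation F := (faces D).

Section FixedLength.
Variable N : nat.
Local Notation K := (koszul D N).
Local Notation kpsi := (psi (kact N : raag D -> _) (kcontr scD N) (@kcoef V D N)).

Lemma kpsi_act (h : raag D) l (c : K) :
  kpsi [seq (h * k)%g | k <- l] c = kpsi l (kact N h c).
Proof. exact: (psi_act _ _ (@kactM V D N)). Qed.

Definition bb_cochain n (c : K) : cochain rat (bb D) n :=
  of_list (fun l => kpsi [seq val x | x <- l] c).

Lemma bb_cochain_linear n a (c c' : K) :
  @bb_cochain n (a *: c + c') = a *: @bb_cochain n c + @bb_cochain n c'.
Proof. by apply/funext=> x; exact: psi_linear. Qed.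

(** Invariance holds because the kernel of [height] fixes radial elements; closedness because [psi]
    is a cochain map. *)
Lemma bb_cochain_cocycle n (c : K) : radial (val c) -> kdiff scD N c = 0 ->
  cocycle_pred (@bb_cochain n c).
Proof.
move=> rc dc; apply/asboolP; split=> [h x|].
  rewrite /bb_cochain /of_list -[in RHS](kact_bb_radial t h rc).
  rewrite -kpsi_act -!map_comp; congr psi.
apply/funext=> x; rewrite (to_listE (cobound _)).
set l := [seq _ | _ <- _].
have sl : size l = n.+2 by rewrite size_map size_enum_ord.
clearbody l.
rewrite to_list_cobound // (@eq_ldiff _ _ (fun m => kpsi (map val m) c) n.+1) //.
  rewrite (ldiff_map val (fun m => kpsi m c)).
  rewrite (ldiff_psi (set0_face D) (@kactM _ _ _) (@kact1 _ _ _)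
    (@kact_d _ _ scD N) (kcontraction scD flagD (N := N)) (kcontr_eta scD N)
    (@kact_eta _ _ _) (@kcoef_eta _ _ _) (@kcoef_d _ _ scD N)) ?size_map ?sl //.
  by rewrite dc psi0.
by move=> m sm; rewrite of_listK.
Qed.

Lemma bounding_pairing n (c : K) (f : {set V} -> rat) (g : raag D) :
  radial (val c) -> kdiff scD N c = 0 -> is_coboundary (@bb_cochain n c) ->
  (forall y, \sum_(A in F | #|A| == n) f A * sdiff y A = 0) ->
  \sum_(A in F | #|A| == n) f A * kcoef D N A (kact N g c) = 0.
Proof.
move=> rc dc bc f0.
apply: (coboundary_pairing (set0_face D) (@faceD1 _ _ scD)
  (@face_gen_comm _ _ scD) (@kactM _ _ _) (@kact1 _ _ _)
  (@kact_d _ _ scD N) (kcontraction scD flagD (N := N)) (kcontr_eta scD N)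
  (@kact_eta _ _ _) (@kcoef_eta _ _ _) (@kcoef_d _ _ scD N)
  (val := val) (r := bb_retract t)) => //.
- exact: bb_retractM.
- exact: bb_translate.
- by move=> x; exact: kact_bb_radial.
case: n bc {f0} => [b0 l sl|n [u [uH uE]]].
  by rewrite -(of_listK (fun l => kpsi (map val l) c) sl) -/(@bb_cochain 0 c) b0.
exists (to_list u) => [x l sl|l sl].
  rewrite /to_list -[RHS](uH x); congr u; apply/funext=> i.
  by rewrite (nth_map 1%g) // sl.
rewrite -(of_listK (fun l => kpsi (map val l) c) sl) -/(@bb_cochain n.+1 c) uE.
by rewrite to_list_cobound.
Qed.

End FixedLength.

Section InfiniteFamily.
Variables (n : nat) (z f : {set V} -> rat).
Hypothesis z_supp : forall A, z A != 0 -> (A \in F) && (#|A| == n).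
Hypothesis z_cocycle : forall A, A \in F -> sdiff z A = 0.
Hypothesis f_cycle :
  forall y, \sum_(A in F | #|A| == n) f A * sdiff y A = 0.
Hypothesis f_z : \sum_(A in F | #|A| == n) f A * z A != 0.

Definition krad (q : nat -> rat) : wcochain V := fun w A => q (size w) * z A.

Lemma krad_good L q : (forall j, (L < j)%N -> q j = 0) ->
  kgood D (L + n) (krad q).
Proof.
move=> q0; apply/asboolP; split=> [A x y a b _|w A].
  by rewrite /krad !size_cat.
apply: contraNeq; rewrite /krad mulf_eq0 negb_or.
move=> /andP[qw /z_supp/andP[-> /eqP ->]].
rewrite leq_add2r leqNgt; apply: contra qw => Lw.
by rewrite q0.
Qed.

Lemma krad_radial q : radial (krad q).
Proof. by move=> w w' A ww'; rewrite /krad ww'. Qed.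

Lemma kd_krad q : kd D (krad q) = 0.
Proof.
apply/funext=> w; apply/funext=> A; rewrite /kd.
have [AF|_] := boolP (A \in F); last by rewrite mul0r.
transitivity (q (size w).+1 * sdiff z A); last by rewrite z_cocycle // mulr0.
rewrite mul1r /sdiff mulr_sumr.
by apply: eq_bigr => v _; rewrite /krad /= mulrCA.
Qed.

Definition rshift (q : nat -> rat) : nat -> rat := fun j => q j + q j.+1.

Lemma kop_krad N v q : kop N (v, true) (krad q) = krad (rshift q).
Proof.
apply/funext=> w; apply/funext=> A; rewrite /kop /krad /rshift /=.
by rewrite size_rcons mulrDl.
Qed.

(** The value of a sequence at [j.+1] is that of its [rshift] at [j] minus its own at [j], so
    vanishing of all iterates spreads from 0 upwards. *)
Lemma iter_rshift_eq0 q : (forall m, iter m rshift q 0%N = 0) ->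
  forall j, q j = 0.
Proof.
move=> q0 j; suff: forall m, iter m rshift q j = 0 by move/(_ 0%N).
elim: j => [//|j IHj] m.
by have := IHj m.+1; rewrite /= {1}/rshift IHj add0r.
Qed.

Lemma cohomology_not_finite_dim : ~ finite_dim (cohomology rat (bb D) n).
Proof.
move=> /finite_dim_dependent[L dep].
(* Indicators of the lengths 0 to [L] give [L.+1] cocycles, enough to force a linear relation
   between their classes. *)
pose delta (i : 'I_L.+1) (j : nat) : rat := (j == i)%:R.
have delta_good i : kgood D (L + n) (krad (delta i)).
  apply: krad_good => j Lj; rewrite /delta; case: eqP => // e.
  by move: Lj; rewrite e ltnNge -ltnS ltn_ord.
pose e i : koszul D (L + n) := Sub (krad (delta i)) (delta_good i).
have e_cocycle i : cocycle_pred (@bb_cochain (L + n) n (e i)).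
  apply: bb_cochain_cocycle; first exact: krad_radial.
  by apply: val_inj; exact: kd_krad.
pose y i : cocycle rat (bb D) n :=
  Sub (@bb_cochain (L + n) n (e i)) (e_cocycle i).
have [a [i0 ai0] a0] := dep (fun i => \pi_(cohomology rat (bb D) n) (y i)).
pose c := \sum_i a i *: e i; pose q j := \sum_i a i * delta i j.
have val_c : val c = krad q.
  apply/funext=> w; apply/funext=> A; rewrite /krad /q mulr_suml /c.
  rewrite (big_morph (fun c : koszul D (L + n) => val c w A)
    (id1 := 0) (op1 := +%R)) //.
  by apply: eq_bigr => i _; rewrite -mulrA.
have bound : is_coboundary (@bb_cochain (L + n) n c).
  have: \sum_i a i *: y i \in @coboundary rat (bb D) n.
    have pi0 : \pi_(cohomology rat (bb D) n) 0 = 0 :> cohomology rat (bb D) n.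
      apply: (addrI (\pi_(cohomology rat (bb D) n) 0)).
      by rewrite -pi_quot_add !addr0.
    rewrite -[X in X \in _]subr0.
    rewrite -[_ \in _]/(_ \in submod_pred (@coboundary rat (bb D) n)).
    rewrite Quotient.idealrBE; apply/eqP; rewrite [RHS]pi0 -[RHS]a0.
    rewrite (big_morph _ (@pi_quot_add _ _ (@coboundary rat (bb D) n)) pi0).
    by apply: eq_bigr => i _; exact/esym/pi_quot_scale.
  move=> /asboolP; congr is_coboundary; apply/funext=> x.
  rewrite (big_morph (fun u : cocycle rat (bb D) n => val u x)
    (id1 := 0) (op1 := +%R)) //.
  rewrite /c (big_morph (fun c : koszul D (L + n) => @bb_cochain _ n c x)
    (id1 := 0) (op1 := +%R)).
  - apply: eq_bigr => i _; rewrite -[a i *: e i]addr0 bb_cochain_linear.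
    rewrite -[RHS]/(a i * @bb_cochain _ n (e i) x + @bb_cochain _ n 0 x).
    by rewrite [bb_cochain 0 x]psi0 addr0.
  - move=> u v; have := bb_cochain_linear n 1 u v.
    by rewrite !scale1r => ->.
  - exact: psi0.
have iter_val m :
    val (kact (L + n) (pres_gen (raag_relator D) t ^+ m : raag D)%g c) =
    krad (iter m rshift q).
  elim: m => [|m IHm]; first by rewrite kact1.
  by rewrite expgSr kactM val_kact_gen IHm kop_krad.
have q0 : forall j, q j = 0.
  apply: iter_rshift_eq0 => m.
  have rc : radial (val c) by rewrite val_c; exact: krad_radial.
  have dc : kdiff scD (L + n) c = 0.
    by apply: val_inj; rewrite -[LHS]/(kd D (val c)) val_c kd_krad.
  (* Pairing at the [m]-th power of [t] reads off [iter m rshift q 0] times the non-zero pairing of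
     [f] with [z]. *)
  have p :=
    bounding_pairing (pres_gen (raag_relator D) t ^+ m)%g rc dc bound f_cycle.
  apply/eqP; apply: contraNT f_z => qm; apply/eqP/(mulfI qm).
  rewrite mulr0 -[RHS]p mulr_sumr; apply: eq_bigr => A _.
  by rewrite /kcoef /= /kcoef_fun iter_val /krad /= mulrCA.
case/eqP: ai0; rewrite -[RHS](q0 i0) /q (bigD1 i0) //= big1 => [|i ii0].
  by rewrite /delta eqxx mulr1 addr0.
rewrite /delta; case: eqP => [/val_inj e0|]; last by rewrite mulr0.
by rewrite e0 eqxx in ii0.
Qed.

End InfiniteFamily.
End Detection.

(** The empty face contributes 1; every other sign is reversed, as the dimension of a simplex is its
    cardinality minus one. *)
Lemma euler_char_faces (V : finType) (D : {set {set V}}) :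
  simplicial_complex D ->
  \sum_(A in faces D) (-1) ^+ #|A| = 1 - euler_char D :> int.
Proof.
case=> D0 _ _; rewrite big_setU1 //= cards0 expr0 /euler_char -sumrN.
congr (_ + _); apply: eq_bigr => A AD.
have A_gt0 : (0 < #|A|)%N.
  by rewrite card_gt0; apply: contraNneq D0 => <-.
by rewrite -[in LHS](prednK A_gt0) exprS mulN1r.
Qed.

Theorem corollary6 (V : finType) (D : {set {set V}}) :
  simplicial_complex D -> flag D -> D != set0 ->
  total_finite_dim (cohomology rat (bb D)) ->
  euler_char D = 1%R.
Proof.
move=> scD flagD Dn0 [fin_dim _]; apply/eqP; rewrite eq_sym -subr_eq0.
rewrite -(euler_char_faces scD); apply/negPn/negP => chi.
have [n [z [f [z_supp z_cocycle f_cycle fz]]]] :=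
  face_cochain_class (@faceD1 _ _ scD) chi.
have [A AD] := set0Pn _ Dn0; have [D0 _ _] := scD.
(* A vertex [t] of some simplex, whose powers give the section of [height]. *)
have [A0|[t _]] := set_0Vmem A; first by rewrite -A0 AD in D0.
exact: (cohomology_not_finite_dim scD flagD t z_supp z_cocycle f_cycle fz).
Qed.
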